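(* Let $k>0$ be a constant time-step, $\nu>0$, let $(\epsilon_n)_{n\ge 1}$ be an arbitrary sequence of positive penalty parameters, let $f^{n+1}\in L^2(\Omega)^d$ for $n\ge 0$, and let $\mathbf u^{-1},\mathbf u^0\in X$ be given. Let $\mathbf u^{n+1}\in X$, $n\ge 0$, be produced by the variable-$\epsilon$ first-order penalty method $$\frac{\mathbf u^{n+1}-\mathbf u^n}{k}+\mathbf u^*\cdot\nabla \mathbf u^{n+1}+\frac12(\nabla\cdot\mathbf u^* )\mathbf u^{n+1}-\nu\Delta\mathbf u^{n+1}-\nabla\Big(\frac1{\epsilon_{n+1}}\nabla\cdot\mathbf u^{n+1}\Big)=f^{n+1},\qquad \mathbf u^*=2\mathbf u^n-\mathbf u^{n-1}.$$ Then the method is stable: for every integer $M>0$ the energy equality $$\frac12\int_\Omega|\mathbf u^M|^2dx+\sum_{n=0}^{M-1}\int_\Omega\Big(\frac12|\mathbf u^{n+1}-\mathbf u^n|^2+k\nu|\nabla\mathbf u^{n+1}|^2+\frac{k}{\epsilon_{n+1}}|\nabla\cdot\mathbf u^{n+1}|^2\Big)dx=\frac12\int_\Omega|\mathbf u^0|^2dx+\sum_{n=0}^{M-1}k\int_\Omega\mathbf u^{n+1}\cdot f^{n+1}dx$$ holds, and the stability bound $$\frac12\int_\Omega|\mathbf u^M|^2dx+\sum_{n=0}^{M-1}\int_\Omega\Big(\frac12|\mathbf u^{n+1}-\mathbf u^n|^2+\frac{k\nu}{2}|\nabla\mathbf u^{n+1}|^2+\frac{k}{\epsilon_{n+1}}|\nabla\cdot\mathbf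 u^{n+1}|^2\Big)dx\le\frac12\int_\Omega|\mathbf u^0|^2dx+\sum_{n=0}^{M-1}\frac{k}{2\nu}\|f^{n+1}\|_{-1}^2$$ holds.
   Context: $\Omega\subset\mathbb R^d$ ($d=2,3$) is a bounded domain; $X=(H_0^1(\Omega))^d$; $\|\cdot\|$ and $(\cdot,\cdot)$ are the $L^2(\Omega)$ norm and inner product; $\|f\|_{-1}=\sup_{0\ne v\in X}(f,v)/\|\nabla v\|$. The equation of the method is understood weakly: for all $v\in X$, $$\tfrac1k(\mathbf u^{n+1}-\mathbf u^n,v)+(\mathbf u^*\cdot\nabla\mathbf u^{n+1},v)+\tfrac12((\nabla\cdot\mathbf u^* )\mathbf u^{n+1},v)+\nu(\nabla\mathbf u^{n+1},\nabla v)+\tfrac1{\epsilon_{n+1}}(\nabla\cdot\mathbf u^{n+1},\nabla\cdot v)=(f^{n+1},v).$$ *)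

(* Defs.v *)
From HB Require Import structures.
From mathcomp Require Import all_boot all_order all_algebra.
From mathcomp Require Import all_classical all_reals all_analysis.

Set Implicit Arguments.
Unset Strict Implicit.
Unset Printing Implicit Defensive.

Import Order.TTheory GRing.Theory Num.Theory.
Import numFieldNormedType.Exports.

Local Open Scope classical_set_scope.
Local Open Scope ring_scope.

(* The sigma-algebra on row vectors is generated by the coordinate maps; over
   the reals it is the Borel sigma-algebra. *)
Definition measure_rV_display : measure_display -> measure_display.
Proof. exact. Qed.

Section measurable_rV.
Context {d} {T : sigmaRingType d}.
Variable n : nat.

Let coors : 'I_n -> 'rV[T]_n -> T := fun i x => x ord0 i.

Let rV_set0 : g_sigma_preimage coors set0.
Proof. exact: sigma_algebra0. Qed.

Let rV_setC A : g_sigma_preimage coors A -> g_sigma_preimage coors (~` A).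
Proof. exact: sigma_algebraC. Qed.

Let rV_bigcup (F : _^nat) : (forall i, g_sigma_preimage coors (F i)) ->
  g_sigma_preimage coors (\bigcup_i (F i)).
Proof. exact: sigma_algebra_bigcup. Qed.

HB.instance Definition _ := @isMeasurable.Build (measure_rV_display d)
  'rV[T]_n (g_sigma_preimage coors) rV_set0 rV_setC rV_bigcup.

End measurable_rV.

Lemma measurable_coord d (T : sigmaRingType d) n (i : 'I_n) :
  measurable_fun [set: 'rV[T]_n] (fun x : 'rV[T]_n => x ord0 i).
Proof.
move=> _ Y mY; rewrite setTI; apply: sub_sigma_algebra => /=.
rewrite -bigcup_seq/=; exists i => /=; first by rewrite mem_index_enum.
by exists Y => //; rewrite setTI.
Qed.

Lemma measurable_fun_rVP d1 d2 (T1 : measurableType d1)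
    (T2 : measurableType d2) n (f : T1 -> 'rV[T2]_n) :
  measurable_fun [set: T1] f <->
  forall i, measurable_fun [set: T1] (fun x => f x ord0 i).
Proof.
split=> [mf i|mf].
  exact: (@measurableT_comp _ _ _ _ _ _ (fun y : 'rV[T2]_n => y ord0 i) _ f
    (measurable_coord i) mf).
move=> _; apply: (@measurability _ _ _ _ [set: T1] f
  (\big[setU/set0]_(i < n)
     preimage_set_system setT (fun x : 'rV[T2]_n => x ord0 i) measurable)) => //.
move=> _ [B + <-]; rewrite -bigcup_seq => -[i /= _ [C mC <-]].
by rewrite !setTI; have := mf i measurableT C mC; rewrite setTI.
Qed.

Section lebesgue_rV.
Context {R : realType}.

Definition rV_cons n (p : R * 'rV[R]_n) : 'rV[R]_n.+1 :=
  \row_i (if unlift ord0 i is Some j then p.2 ord0 j else p.1).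

Definition rV_uncons n (x : 'rV[R]_n.+1) : R * 'rV[R]_n :=
  (x ord0 ord0, \row_i x ord0 (lift ord0 i)).

Lemma rV_consK n : cancel (@rV_cons n) (@rV_uncons n).
Proof.
move=> [a x]; rewrite /rV_uncons mxE unlift_none; congr pair.
by apply/rowP => i; rewrite !mxE liftK.
Qed.

Lemma rV_unconsK n : cancel (@rV_uncons n) (@rV_cons n).
Proof.
move=> x; apply/rowP => i; rewrite mxE.
by case: unliftP => [j ->|->] //=; rewrite mxE.
Qed.

Lemma measurable_rV_cons n : measurable_fun setT (@rV_cons n).
Proof.
apply/measurable_fun_rVP => i; rewrite /rV_cons.
under eq_fun do rewrite mxE.
case: (unlift _ i) => [j|]; last exact: measurable_fst.
exact: (measurableT_comp (measurable_coord j) measurable_snd).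
Qed.

Lemma measurable_rV_uncons n : measurable_fun setT (@rV_uncons n).
Proof.
apply: measurable_fun_pair; first exact: measurable_coord.
apply/measurable_fun_rVP => i; under eq_fun do rewrite mxE.
exact: measurable_coord.
Qed.

Section step.
Variables (n : nat) (m : {sigma_finite_measure set 'rV[R]_n -> \bar R}).
Local Notation prod_measure := (@lebesgue_measure R \x m)%E.

Definition lebesgue_rV_step : set 'rV[R]_n.+1 -> \bar R :=
  pushforward prod_measure (@rV_cons n).

Let step0 : lebesgue_rV_step set0 = 0%E.
Proof. by rewrite /lebesgue_rV_step /pushforward preimage_set0 measure0. Qed.

Let step_ge0 A : (0 <= lebesgue_rV_step A)%E.
Proof. exact: (measure_ge0 prod_measure). Qed.

Let step_sigma_additive : semi_sigma_additive lebesgue_rV_step.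
Proof.
move=> F mF tF mUF; rewrite /lebesgue_rV_step /pushforward preimage_bigcup.
apply: measure_semi_sigma_additive.
- by move=> k; rewrite -[X in measurable X]setTI; exact: measurable_rV_cons.
- apply/trivIsetP => /= i j _ _ ij; rewrite -preimage_setI.
  by move/trivIsetP : tF => /(_ _ _ _ _ ij) ->//; rewrite preimage_set0.
- rewrite -preimage_bigcup -[X in measurable X]setTI.
  exact: measurable_rV_cons.
Qed.

HB.instance Definition _ :=
  isMeasure.Build _ _ _ lebesgue_rV_step step0 step_ge0 step_sigma_additive.

Let prod_sigma_finite : sigma_finite setT prod_measure.
Proof.
have /sigma_finiteP[F [TF ndF Foo]] := sigma_finiteT (@lebesgue_measure R).
have /sigma_finiteP[G [TG ndG Goo]] := sigma_finiteT m.
exists (fun k => F k `*` G k).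
  rewrite -setXTT TF TG predeqE => -[x y]; split.
    move=> [/= [i _ Fix] [j _ Gjy]]; exists (maxn i j) => //; split.
    - by move: x Fix; exact/subsetPset/ndF/leq_maxl.
    - by move: y Gjy; exact/subsetPset/ndG/leq_maxr.
  by move=> [k _ []/= ? ?]; split; exists k.
move=> k; have [? ?] := Foo k; have [? ?] := Goo k.
split; first exact: measurableX.
by rewrite product_measure1E// lte_mul_pinfty// ge0_fin_numE.
Qed.

Let step_sigma_finite : sigma_finite setT lebesgue_rV_step.
Proof.
have [F TF Foo] := prod_sigma_finite.
exists (fun k => @rV_uncons n @^-1` F k).
  by rewrite -preimage_bigcup -TF preimage_setT.
move=> k; have [mF Fk] := Foo k; split.
  by rewrite -[X in measurable X]setTI; exact: measurable_rV_uncons.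
rewrite /lebesgue_rV_step /pushforward (_ : _ @^-1` _ = F k)//.
by apply/seteqP; split=> p /=; rewrite rV_consK.
Qed.

HB.instance Definition _ := Measure_isSigmaFinite.Build _ _ _
  lebesgue_rV_step step_sigma_finite.

End step.

Fixpoint lebesgue_rV n : {sigma_finite_measure set 'rV[R]_n -> \bar R} :=
  if n is n'.+1 then lebesgue_rV_step (lebesgue_rV n')
  else \d_(0 : 'rV[R]_0).

(* Together with sigma-finiteness this determines the measure. *)
Lemma lebesgue_rV_box n (A : 'I_n -> set R) :
  (forall i, measurable (A i)) ->
  lebesgue_rV n [set x | forall i, A i (x ord0 i)] =
  (\prod_(i < n) lebesgue_measure (A i))%E.
Proof.
elim: n A => [|n IHn] A mA.
  by rewrite big_ord0 /= diracE mem_set// => -[].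
rewrite big_ord_recl -IHn; last by move=> i.
rewrite /= /lebesgue_rV_step /pushforward.
rewrite (_ : _ @^-1` _ =
  A ord0 `*` [set x : 'rV_n | forall i, A (lift ord0 i) (x ord0 i)]).
  rewrite product_measure1E//; first exact: mA.
  rewrite [X in measurable X](_ : _ =
    \bigcap_(i in [set: 'I_n]) ((fun x : 'rV[R]_n => x ord0 i) @^-1`
      A (lift ord0 i))).
    apply: fin_bigcap_measurable => // i _.
    by rewrite -[X in measurable X]setTI; exact: measurable_coord.
  by apply/seteqP; split=> [x Ax i _|x Ax i]; exact: Ax.
apply/seteqP; split=> [[a x]/= Ax|[a x]/= [A0 Ax] i].
  split=> [|i]; first by have := Ax ord0; rewrite mxE unlift_none.
  by have := Ax (lift ord0 i); rewrite mxE liftK.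
by rewrite mxE; case: unliftP => [j ->|->].
Qed.

End lebesgue_rV.

Section sobolev.
Context {R : realType} {d : nat}.
Notation point := 'rV[R]_d.
Notation mu := (@lebesgue_rV R d).
Implicit Types (Omega : set point) (u g phi : point -> R) (i : 'I_d).

Definition bounded_domain Omega :=
  [/\ open Omega, connected Omega, Omega !=set0 & bounded_set Omega].

Definition partial i u : point -> R := 'D_(delta_mx ord0 i) u.

Fixpoint Ck k u : Prop :=
  if k is k'.+1 then
    [/\ continuous u, forall i x, derivable u x (delta_mx ord0 i)
      & forall i, Ck k' (partial i u)]
  else continuous u.

Definition test_function Omega phi :=
  [/\ forall k, Ck k phi, compact (closure [set x | phi x != 0])
    & closure [set x | phi x != 0] `<=` Omega].

Definition L2 Omega u : Prop := u \_ Omega \in Lfun mu 2%:E.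

Definition is_weak_partial Omega i u g :=
  forall phi, test_function Omega phi ->
    \int[mu]_(x in Omega) (u x * partial i phi x) =
    - \int[mu]_(x in Omega) (g x * phi x).

(* A square-integrable weak derivative, junk if there is none; it is unique up
   to equality almost everywhere on Omega. *)
Definition weak_partial Omega i u : point -> R :=
  get [set g | L2 Omega g /\ is_weak_partial Omega i u g].

Definition H1 Omega u :=
  L2 Omega u /\ forall i, exists g, L2 Omega g /\ is_weak_partial Omega i u g.

Definition H1norm Omega u : R :=
  Num.sqrt (\int[mu]_(x in Omega) (u x ^+ 2) +
            \sum_i \int[mu]_(x in Omega) (weak_partial Omega i u x ^+ 2)).

(* The closure of the test functions in the H^1 norm. *)
Definition H10 Omega u :=
  H1 Omega u /\ forall e : R, 0 < e ->
    exists2 phi, test_function Omega phi & H1norm Omega (u \- phi) < e.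

End sobolev.

Section vector_fields.
Context {R : realType} {d : nat}.
Notation point := 'rV[R]_d.
Notation mu := (@lebesgue_rV R d).
Implicit Types (Omega : set point) (u v w f : point -> 'rV[R]_d).

Definition component i u : point -> R := fun x => u x ord0 i.

Definition L2_field Omega f := forall i, L2 Omega (component i f).

Definition H10_field Omega u := forall i, H10 Omega (component i u).

(* The (i, j) entry is the j-th weak partial derivative of u_i. *)
Definition weak_grad Omega u : point -> 'M[R]_d :=
  fun x => \matrix_(i, j) weak_partial Omega j (component i u) x.

Definition weak_div Omega u : point -> R := fun x => \tr (weak_grad Omega u x).

Definition advect Omega w u : point -> 'rV[R]_d :=
  fun x => \row_i \sum_j w x ord0 j * weak_grad Omega u x i j.

Definition mxdot m n (A B : 'M[R]_(m, n)) : R := \sum_i \sum_j A i j * B i j.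

Definition L2inner Omega m n (F G : point -> 'M[R]_(m, n)) : R :=
  \int[mu]_(x in Omega) mxdot (F x) (G x).

Definition L2norm Omega m n (F : point -> 'M[R]_(m, n)) : R :=
  Num.sqrt (L2inner Omega F F).

(* For f in L^2 and Omega bounded the set is bounded above, by the Poincare
   inequality; v <> 0 is meant in L^2(Omega), i.e. up to null sets. *)
Definition dual_norm Omega f : R :=
  sup [set L2inner Omega f v / L2norm Omega (weak_grad Omega v) | v in
    [set v | H10_field Omega v /\ ~ {ae mu, forall x, Omega x -> v x = 0}]].

(* u n stands for u^n (n >= 0) and um1 for u^(-1). *)
Definition extrapolate um1 (u : nat -> point -> 'rV[R]_d) n :
    point -> 'rV[R]_d :=
  fun x => 2 *: u n x - (if n is m.+1 then u m else um1) x.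

Definition penalty_step Omega (k nu eps : R) f w u_old u_new :=
  forall v, H10_field Omega v ->
    k^-1 * L2inner Omega (fun x => u_new x - u_old x) v
    + L2inner Omega (advect Omega w u_new) v
    + 2^-1 * L2inner Omega (fun x => weak_div Omega w x *: u_new x) v
    + nu * L2inner Omega (weak_grad Omega u_new) (weak_grad Omega v)
    + eps^-1 * \int[mu]_(x in Omega) (weak_div Omega u_new x * weak_div Omega v x)
    = L2inner Omega f v.

End vector_fields.

(* Main.v *)
Require Import Defs.
From mathcomp Require Import all_boot all_order all_algebra.
From mathcomp Require Import all_classical all_reals all_analysis.
From mathcomp Require Import measurable_realfun ring lra.

(** Take v = u^(n+1) in the weak equation. The identity
    (a - b) . a = (|a|^2 - |b|^2 + |a - b|^2) / 2 turns the difference quotient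
    into a telescoping term and half the squared increment, the viscous and the
    penalty terms become squares, and the two terms containing
    w = 2 u^n - u^(n-1) cancel ([convection_eq0]). Multiplying by k and summing
    over n gives the energy equality. The stability bound follows from
    (f, u) <= |f|_(-1) |grad u| ([dual_pairing]) and the inequality of Young.

    The cancellation is the delicate point. For a smooth compactly supported u
    it is an integration by parts against u^2, but here w and u are only in
    H^1_0, and already the integrability of w_j (d_j u_i) u_i requires them to
    be in L^4. This is where the dimension enters: [sobolev_L4] bounds the L^4
    norm of a test function by its H^1 norm. Along each coordinate line phi^2 is
    at most the integral of |2 phi d_i phi|; in the plane the product of two such
    bounds separates the variables, and space is sliced into planes on which
    the L^2 norms are uniformly bounded. The bound passes from test functions to
    H^1_0 by lower semicontinuity of the L^4 norm
    ([L4_lower_semicontinuous]), which yields approximation by test functions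
    in L^4 ([H10_approx]), and the cancellation passes to the limit
    ([skew_symmetry]).

    [weak_partial] selects one weak derivative among all those of a function. Two
    candidates differ by a function orthogonal to the test functions
    ([test_null]). So the derivatives of the approximating test functions
    converge to the selected one in L^2 only after adding such functions. These
    corrections are harmless because they always get paired with L^2 limits of
    test functions.

    The dual norm is the supremum of a set of quotients, and it bounds
    each of them only if the set is bounded: this is the Poincare inequality
    ([poincare_field]), a consequence of integrating the divergence of
    phi^2 x_i e_i over the bounded set Omega. *)

Set Implicit Arguments.
Unset Strict Implicit.
Unset Printing Implicit Defensive.

Import Order.TTheory GRing.Theory Num.Theory.
Import numFieldNormedType.Exports.

Local Open Scope classical_set_scope.
Local Open Scope ring_scope.

(** * Square-integrable functions *)

Section square_integrable.
Context d (T : measurableType d) (R : realType).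
Variables (mu : {measure set T -> \bar R}) (D : set T).
Hypothesis mD : measurable D.
Implicit Types f g h : T -> R.

Definition rintegrable f := mu.-integrable D (EFin \o f).

Lemma rintegrable_le f g : measurable_fun D f -> rintegrable g ->
  (forall x, D x -> `|f x| <= g x) -> rintegrable f.
Proof.
move=> mf ig fg; apply: (le_integrable mD _ _ ig).
  exact/measurable_EFinP.
move=> x Dx /=; rewrite lee_fin (le_trans (fg _ Dx))//; exact: ler_norm.
Qed.

Lemma rintegrableD f g : rintegrable f -> rintegrable g -> rintegrable (fun x => f x + g x).
Proof.
by move=> iF iG; have := integrableD mD iF iG; apply: eq_integrable.
Qed.

Lemma rintegrableZ c f : rintegrable f -> rintegrable (fun x => c * f x).
Proof.
by move=> iF; have := integrableZl mD c iF; apply: eq_integrable.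
Qed.

Lemma rintegrableB f g : rintegrable f -> rintegrable g -> rintegrable (fun x => f x - g x).
Proof.
by move=> iF iG; have := integrableB mD iF iG; apply: eq_integrable.
Qed.

Lemma rintegrable_sum I (s : seq I) (F : I -> T -> R) :
  (forall i, rintegrable (F i)) -> rintegrable (fun x => \sum_(i <- s) F i x).
Proof.
move=> iF; elim: s => [|i s IHs].
  rewrite (_ : (fun x => _) = cst 0); first exact: integrable0.
  by apply/funext => x; rewrite big_nil.
rewrite (_ : (fun x => _) = (fun x => F i x + \sum_(j <- s) F j x)).
  exact: rintegrableD.
by apply/funext => x; rewrite big_cons.
Qed.

Lemma Rintegral_sum I (s : seq I) (F : I -> T -> R) :
  (forall i, rintegrable (F i)) ->
  \int[mu]_(x in D) (\sum_(i <- s) F i x) =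
  \sum_(i <- s) \int[mu]_(x in D) F i x.
Proof.
move=> iF; elim: s => [|i s IHs].
  rewrite big_nil; under eq_Rintegral do rewrite big_nil.
  by rewrite Rintegral_cst// mul0r.
rewrite big_cons -IHs -RintegralD; [|by []|exact: iF|exact: rintegrable_sum].
by apply: eq_Rintegral => x _; rewrite big_cons.
Qed.

Definition sqint f := measurable_fun D f /\ rintegrable (fun x => f x ^+ 2).

Definition L2nrm f : R := Num.sqrt (\int[mu]_(x in D) (f x ^+ 2)).

Lemma sqint_rintegrableM f g : sqint f -> sqint g -> rintegrable (fun x => f x * g x).
Proof.
move=> [mf if2] [mg ig2].
apply: (@rintegrable_le _ (fun x => f x ^+ 2 + g x ^+ 2)).
- exact: measurable_funM.
- exact: rintegrableD.
- by move=> x _; rewrite ler_norml; apply/andP; split; nra.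
Qed.

Lemma sqint_lin a b f g : sqint f -> sqint g ->
  sqint (fun x => a * f x + b * g x).
Proof.
move=> sf sg; have [mf if2] := sf; have [mg ig2] := sg; split.
  by apply: measurable_funD; apply: measurable_funM => //; exact: measurable_cst.
rewrite (_ : (fun x => _) = (fun x => a ^+ 2 * f x ^+ 2 +
    (2 * a * b) * (f x * g x) + b ^+ 2 * g x ^+ 2)).
  by do ![apply: rintegrableD|apply: rintegrableZ] => //; exact: sqint_rintegrableM.
by apply/funext => x; ring.
Qed.

Lemma eq_sqint f g : f =1 g -> sqint f -> sqint g.
Proof. by move=> /funext ->. Qed.

Lemma sqintD f g : sqint f -> sqint g -> sqint (fun x => f x + g x).
Proof.
by move=> sf sg; have := sqint_lin 1 1 sf sg; apply: eq_sqint => x; rewrite !mul1r.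
Qed.

Lemma sqintB f g : sqint f -> sqint g -> sqint (fun x => f x - g x).
Proof.
move=> sf sg; have := sqint_lin 1 (-1) sf sg.
by apply: eq_sqint => x; rewrite mul1r mulN1r.
Qed.

Lemma sqintZ c f : sqint f -> sqint (fun x => c * f x).
Proof.
by move=> sf; have := sqint_lin c 0 sf sf; apply: eq_sqint => x; rewrite mul0r addr0.
Qed.

Lemma sqint_le f g : measurable_fun D f -> sqint g ->
  (forall x, D x -> `|f x| <= g x) -> sqint f.
Proof.
move=> mf [mg ig2] fg; split=> //; apply: (@rintegrable_le _ (fun x => g x ^+ 2)) => //.
  exact: measurable_funX.
move=> x Dx; rewrite ger0_norm ?sqr_ge0// -[f x ^+ 2]real_normK ?num_real//.
by rewrite lerXn2r ?nnegrE// ?fg// (le_trans _ (fg _ Dx)).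
Qed.

Lemma L2nrm_ge0 f : 0 <= L2nrm f. Proof. exact: sqrtr_ge0. Qed.

Lemma sqr_L2nrm f : L2nrm f ^+ 2 = \int[mu]_(x in D) (f x ^+ 2).
Proof. by rewrite sqr_sqrtr// Rintegral_ge0// => x _; exact: sqr_ge0. Qed.

Lemma Rintegral_lin a b f g : rintegrable f -> rintegrable g ->
  \int[mu]_(x in D) (a * f x + b * g x) =
  a * \int[mu]_(x in D) f x + b * \int[mu]_(x in D) g x.
Proof. by move=> iF iG; rewrite RintegralD ?RintegralZl//; exact: rintegrableZ. Qed.

Lemma Rintegral_sqr_lin a b f g : sqint f -> sqint g ->
  \int[mu]_(x in D) ((a * f x + b * g x) ^+ 2) =
  a ^+ 2 * L2nrm f ^+ 2 + 2 * a * b * \int[mu]_(x in D) (f x * g x)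
  + b ^+ 2 * L2nrm g ^+ 2.
Proof.
move=> sf sg; have [mf if2] := sf; have [mg ig2] := sg.
have ifg := sqint_rintegrableM sf sg.
rewrite !sqr_L2nrm -!RintegralZl// -!RintegralD//.
- by apply: eq_Rintegral => x _; ring.
- by apply: rintegrableD; exact: rintegrableZ.
- exact: rintegrableZ.
- exact: rintegrableZ.
- exact: rintegrableZ.
Qed.

(** The integral of (a f + b g)^2 is a nonnegative quadratic form in (a, b),
    so its discriminant is nonpositive. *)
Lemma cauchy_schwarz f g : sqint f -> sqint g ->
  `|\int[mu]_(x in D) (f x * g x)| <= L2nrm f * L2nrm g.
Proof.
move=> sf sg.
have P a b : 0 <= a ^+ 2 * L2nrm f ^+ 2 + 2 * a * b * \int[mu]_(x in D) (f x * g x)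
    + b ^+ 2 * L2nrm g ^+ 2.
  rewrite -Rintegral_sqr_lin//; apply: Rintegral_ge0 => x _; exact: sqr_ge0.
move: (\int[mu]_(x in D) _) (L2nrm_ge0 f) (L2nrm_ge0 g) P => I.
move: (L2nrm f) (L2nrm g) => a b a0 b0 P.
have [b_eq0|bn0] := eqVneq b 0.
  have [->|I0] := eqVneq I 0; first by rewrite normr0 b_eq0 mulr0.
  (* Without its square term the form is affine in the second coefficient,
     which is chosen here to make its value -1. *)
  have := P 1 (- (a ^+ 2 + 1) / (2 * I)); rewrite b_eq0.
  have -> : 2 * 1 * (- (a ^+ 2 + 1) / (2 * I)) * I = - (a ^+ 2 + 1) by field.
  by move=> Q; exfalso; lra.
(* Up to scaling, the minimizer of the form. *)
have := P (b ^+ 2) (- I); have : 0 < b ^+ 2 by rewrite exprn_gt0// lt0r bn0.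
move=> b2 Q.
have : I ^+ 2 <= (a * b) ^+ 2.
  rewrite -(ler_pM2l b2); nra.
by rewrite -[I ^+ 2]real_normK ?num_real// ler_pXn2r ?nnegrE ?mulr_ge0.
Qed.

Lemma L2nrmZ c f : sqint f -> L2nrm (fun x => c * f x) = `|c| * L2nrm f.
Proof.
move=> [mf if2]; rewrite /L2nrm.
under eq_Rintegral do rewrite exprMn.
by rewrite RintegralZl// sqrtrM ?sqr_ge0// sqrtr_sqr.
Qed.

Lemma le_L2nrm f g : sqint f -> sqint g -> (forall x, D x -> `|f x| <= `|g x|) ->
  L2nrm f <= L2nrm g.
Proof.
move=> [mf if2] [mg ig2] fg; rewrite ler_wsqrtr//; apply: le_Rintegral => // x Dx.
by rewrite -[f x ^+ 2]real_normK -1?[g x ^+ 2]real_normK ?num_real// lerXn2r ?nnegrE// fg.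
Qed.

Lemma L2nrmD f g : sqint f -> sqint g ->
  L2nrm (fun x => f x + g x) <= L2nrm f + L2nrm g.
Proof.
move=> sf sg; rewrite -(ler_pXn2r (ltn0Sn 1)) ?nnegrE ?addr_ge0 ?L2nrm_ge0//.
rewrite sqr_L2nrm.
have := Rintegral_sqr_lin 1 1 sf sg.
rewrite (_ : (fun x => (1 * f x + 1 * g x) ^+ 2) = (fun x => (f x + g x) ^+ 2)).
  move=> ->; have := cauchy_schwarz sf sg; rewrite ler_norml => /andP[_ H]; nra.
by apply/funext => x; rewrite !mul1r.
Qed.

Lemma L2nrmN f g : L2nrm (fun x => f x - g x) = L2nrm (fun x => g x - f x).
Proof. by congr Num.sqrt; apply: eq_Rintegral => x _; ring. Qed.

Lemma L2nrmB f g : sqint f -> sqint g ->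
  L2nrm (fun x => f x - g x) <= L2nrm f + L2nrm g.
Proof.
move=> sf sg; have := L2nrmD sf (sqintZ (-1) sg).
rewrite L2nrmZ// normrN1 mul1r.
by rewrite (_ : (fun x => f x + -1 * g x) = (fun x => f x - g x))//;
  apply/funext => x; rewrite mulN1r.
Qed.

Lemma L2nrm_triangle g f h : sqint f -> sqint g -> sqint h ->
  L2nrm (fun x => f x - h x) <= L2nrm (fun x => f x - g x) + L2nrm (fun x => g x - h x).
Proof.
move=> sf sg sh.
rewrite (_ : (fun x => f x - h x) = (fun x => (f x - g x) + (g x - h x))).
  by apply: L2nrmD; exact: sqintB.
by apply/funext => x; ring.
Qed.

Lemma L2nrmM f g : sqint (fun x => f x ^+ 2) -> sqint (fun x => g x ^+ 2) ->
  L2nrm (fun x => f x * g x) ^+ 2 <=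
  L2nrm (fun x => f x ^+ 2) * L2nrm (fun x => g x ^+ 2).
Proof.
move=> sf sg; apply: le_trans (cauchy_schwarz sf sg).
rewrite sqr_L2nrm; under eq_Rintegral do rewrite exprMn.
exact: ler_norm.
Qed.

Lemma sqintM f g : measurable_fun D f -> measurable_fun D g ->
  sqint (fun x => f x ^+ 2) -> sqint (fun x => g x ^+ 2) ->
  sqint (fun x => f x * g x).
Proof.
move=> mf mg sf sg; split; first exact: measurable_funM.
rewrite (_ : (fun x => _) = (fun x => f x ^+ 2 * g x ^+ 2)).
  exact: sqint_rintegrableM.
by apply/funext => x; rewrite exprMn.
Qed.

Definition cvgL2 (a : nat -> T -> R) f :=
  [/\ forall n, sqint (a n), sqint f
    & L2nrm (fun x => a n x - f x) @[n --> \oo] --> 0].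

Lemma cvgL2_cst f : sqint f -> cvgL2 (fun=> f) f.
Proof.
move=> sf; split=> //; rewrite (_ : (fun n => _) = cst 0); first exact: cvg_cst.
apply/funext => n; rewrite /L2nrm; under eq_Rintegral do rewrite subrr expr0n /=.
by rewrite Rintegral_cst// mul0r sqrtr0.
Qed.

Lemma squeeze0 (u v : nat -> R) : (forall n, 0 <= u n <= v n) ->
  v n @[n --> \oo] --> 0 -> u n @[n --> \oo] --> 0.
Proof.
move=> uv v0; apply: (squeeze_cvgr _ (cvg_cst 0) v0).
by apply: nearW => n; exact: uv.
Qed.

Lemma cvgL2_Rintegral (a b : nat -> T -> R) f g : cvgL2 a f -> cvgL2 b g ->
  \int[mu]_(x in D) (a n x * b n x) @[n --> \oo] --> \int[mu]_(x in D) (f x * g x).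
Proof.
move=> [sa sf af] [sb sg bg]; apply/subr_cvg0; apply/norm_cvg0P.
pose A n := L2nrm (fun x => a n x - f x); pose B n := L2nrm (fun x => b n x - g x).
apply: (@squeeze0 _ (fun n => A n * B n + (A n * L2nrm g + L2nrm f * B n))).
  move=> n; rewrite normr_ge0/=.
  have sda := sqintB (sa n) sf; have sdb := sqintB (sb n) sg.
  have i1 := sqint_rintegrableM sda sdb; have i2 := sqint_rintegrableM sda sg.
  have i3 := sqint_rintegrableM sf sdb; have ifg := sqint_rintegrableM sf sg.
  rewrite (_ : (fun x => a n x * b n x) = (fun x => f x * g x +
      ((a n x - f x) * (b n x - g x) + ((a n x - f x) * g x + f x * (b n x - g x))))).
    rewrite !RintegralD//; try by repeat apply: rintegrableD.
    rewrite addrAC subrr add0r.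
    apply: le_trans (ler_normD _ _) _; apply: lerD; first exact: cauchy_schwarz.
    by apply: le_trans (ler_normD _ _) _; apply: lerD; exact: cauchy_schwarz.
  by apply/funext => x; ring.
rewrite -[X in _ --> X](_ : 0 * 0 + (0 * L2nrm g + L2nrm f * 0) = 0); last ring.
apply: cvgD; first exact: cvgM.
by apply: cvgD; apply: cvgM => //; exact: cvg_cst.
Qed.

Lemma cvgL2D (a b : nat -> T -> R) f g : cvgL2 a f -> cvgL2 b g ->
  cvgL2 (fun n x => a n x + b n x) (fun x => f x + g x).
Proof.
move=> [sa sf af] [sb sg bg]; split=> [n||]; [exact: sqintD|exact: sqintD|].
apply: squeeze0; last by rewrite -[X in _ --> X]addr0; exact: (cvgD af bg).
move=> n; rewrite L2nrm_ge0/=.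
rewrite (_ : (fun x => _ - _) = (fun x => (a n x - f x) + (b n x - g x))).
  by apply: L2nrmD; exact: sqintB.
by apply/funext => x; ring.
Qed.

Lemma cvgL2Z c (a : nat -> T -> R) f : cvgL2 a f ->
  cvgL2 (fun n x => c * a n x) (fun x => c * f x).
Proof.
move=> [sa sf af]; split=> [n||]; [exact: sqintZ|exact: sqintZ|].
rewrite -[X in _ --> X](mulr0 `|c|).
rewrite (_ : (fun n => _) = (fun n => `|c| * L2nrm (fun x => a n x - f x))).
  by apply: cvgM => //; exact: cvg_cst.
apply/funext => n; rewrite -L2nrmZ; last exact: sqintB.
by congr L2nrm; apply/funext => x; ring.
Qed.

(** The square of the L^4 norm of g is the L^2 norm of g^2, and in this form every
    L^4 estimate is an instance of the L^2 theory. Convergence in L^2 is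
    required separately because D may have infinite measure. *)
Definition cvgL4 (a : nat -> T -> R) f :=
  [/\ cvgL2 a f, forall n, sqint (fun x => a n x ^+ 2), sqint (fun x => f x ^+ 2)
    & L2nrm (fun x => (a n x - f x) ^+ 2) @[n --> \oo] --> 0].

Lemma sqint_sqr_lin a b f g : measurable_fun D f -> measurable_fun D g ->
  sqint (fun x => f x ^+ 2) -> sqint (fun x => g x ^+ 2) ->
  sqint (fun x => (a * f x + b * g x) ^+ 2).
Proof.
move=> mf mg sf sg.
have := sqintD (sqintZ (2 * a ^+ 2) sf) (sqintZ (2 * b ^+ 2) sg) => sfg.
apply: (sqint_le _ sfg).
  apply: measurable_funX; apply: measurable_funD;
    by apply: measurable_funM => //; exact: measurable_cst.
move=> x _; rewrite ger0_norm ?sqr_ge0// -subr_ge0.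
rewrite (_ : _ - _ = (a * f x - b * g x) ^+ 2) ?sqr_ge0//; ring.
Qed.

Lemma sqint_sqrD f g : measurable_fun D f -> measurable_fun D g ->
  sqint (fun x => f x ^+ 2) -> sqint (fun x => g x ^+ 2) ->
  sqint (fun x => (f x + g x) ^+ 2).
Proof.
move=> mf mg sf sg; have := sqint_sqr_lin 1 1 mf mg sf sg.
by apply: eq_sqint => x; rewrite !mul1r.
Qed.

Lemma sqint_sqrB f g : measurable_fun D f -> measurable_fun D g ->
  sqint (fun x => f x ^+ 2) -> sqint (fun x => g x ^+ 2) ->
  sqint (fun x => (f x - g x) ^+ 2).
Proof.
move=> mf mg sf sg; have := sqint_sqr_lin 1 (-1) mf mg sf sg.
by apply: eq_sqint => x; rewrite mul1r mulN1r.
Qed.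

Lemma L2nrm_sqrD f g : measurable_fun D f -> measurable_fun D g ->
  sqint (fun x => f x ^+ 2) -> sqint (fun x => g x ^+ 2) ->
  L2nrm (fun x => (f x + g x) ^+ 2) <=
  2 * L2nrm (fun x => f x ^+ 2) + 2 * L2nrm (fun x => g x ^+ 2).
Proof.
move=> mf mg sf sg.
rewrite -[2]ger0_norm// -(L2nrmZ _ sf) -(L2nrmZ _ sg).
apply: le_trans (L2nrmD (sqintZ _ sf) (sqintZ _ sg)).
have sfg := sqintD (sqintZ 2 sf) (sqintZ 2 sg).
apply: (le_L2nrm (sqint_sqrD mf mg sf sg) sfg) => x _.
rewrite [leLHS]ger0_norm ?sqr_ge0// ger0_norm.
  rewrite -subr_ge0 (_ : _ - _ = (f x - g x) ^+ 2) ?sqr_ge0//; ring.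
by apply: addr_ge0; apply: mulr_ge0 => //; exact: sqr_ge0.
Qed.

Lemma cvgL4_cst f : sqint f -> sqint (fun x => f x ^+ 2) -> cvgL4 (fun=> f) f.
Proof.
move=> sf sf2; split=> //; first exact: cvgL2_cst.
rewrite (_ : (fun n => _) = cst 0); first exact: cvg_cst.
apply/funext => n; rewrite /L2nrm; under eq_Rintegral do rewrite subrr !expr0n /=.
by rewrite Rintegral_cst// mul0r sqrtr0.
Qed.

Lemma cvgL4D (a b : nat -> T -> R) f g : cvgL4 a f -> cvgL4 b g ->
  cvgL4 (fun n x => a n x + b n x) (fun x => f x + g x).
Proof.
move=> [ca a2 f2 af] [cb b2 g2 bg].
have [sa [mf _] _] := ca; have [sb [mg _] _] := cb.
have ma n : measurable_fun D (a n) by case: (sa n).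
have mb n : measurable_fun D (b n) by case: (sb n).
split; [exact: cvgL2D|by move=> n; exact: sqint_sqrD|exact: sqint_sqrD|].
apply: (@squeeze0 _ (fun n => 2 * L2nrm (fun x => (a n x - f x) ^+ 2) +
    2 * L2nrm (fun x => (b n x - g x) ^+ 2))).
  move=> n; rewrite L2nrm_ge0/=.
  rewrite (_ : (fun x => (a n x + b n x - _) ^+ 2) =
    (fun x => ((a n x - f x) + (b n x - g x)) ^+ 2)).
    by apply: L2nrm_sqrD; try exact: measurable_funB; exact: sqint_sqrB.
  by apply/funext => x; ring.
rewrite -[X in _ --> X](_ : 2 * 0 + 2 * 0 = 0); last ring.
by apply: cvgD; apply: cvgM => //; exact: cvg_cst.
Qed.

Lemma cvgL4Z c (a : nat -> T -> R) f : cvgL4 a f ->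
  cvgL4 (fun n x => c * a n x) (fun x => c * f x).
Proof.
move=> [ca a2 f2 af]; have [sa [mf _] _] := ca.
have ma n : measurable_fun D (a n) by case: (sa n).
split; first exact: cvgL2Z.
- by move=> n; have := sqintZ (c ^+ 2) (a2 n); apply: eq_sqint => x; rewrite exprMn.
- by have := sqintZ (c ^+ 2) f2; apply: eq_sqint => x; rewrite exprMn.
rewrite -[X in _ --> X](mulr0 `|c ^+ 2|).
rewrite (_ : (fun n => _) = (fun n => `|c ^+ 2| * L2nrm (fun x => (a n x - f x) ^+ 2))).
  by apply: cvgM => //; exact: cvg_cst.
apply/funext => n; rewrite -L2nrmZ; last exact: sqint_sqrB.
by congr L2nrm; apply/funext => x; ring.
Qed.

(** Cauchy-Schwarz for squares ([L2nrmM]), after expanding the error as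
    (a - f)(b - g) + (a - f) g + f (b - g). *)
Lemma cvgL4M (a b : nat -> T -> R) f g : cvgL4 a f -> cvgL4 b g ->
  cvgL2 (fun n x => a n x * b n x) (fun x => f x * g x).
Proof.
move=> [ca a2 f2 af] [cb b2 g2 bg].
have [sa [mf _] _] := ca; have [sb [mg _] _] := cb.
have ma n : measurable_fun D (a n) by case: (sa n).
have mb n : measurable_fun D (b n) by case: (sb n).
split; [by move=> n; exact: sqintM|exact: sqintM|].
pose A n : R := L2nrm (fun x => (a n x - f x) ^+ 2).
pose B n : R := L2nrm (fun x => (b n x - g x) ^+ 2).
pose E n : R := Num.sqrt (A n * B n) + (Num.sqrt (A n * L2nrm (fun x => g x ^+ 2)) +
  Num.sqrt (L2nrm (fun x => f x ^+ 2) * B n)).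
have leM (p q : T -> R) : measurable_fun D p -> measurable_fun D q ->
    sqint (fun x => p x ^+ 2) -> sqint (fun x => q x ^+ 2) ->
    L2nrm (fun x => p x * q x) <=
    Num.sqrt (L2nrm (fun x => p x ^+ 2) * L2nrm (fun x => q x ^+ 2)).
  move=> mp mq sp sq; rewrite -[leLHS]ger0_norm ?L2nrm_ge0// -sqrtr_sqr.
  by rewrite ler_wsqrtr// L2nrmM.
apply: (@squeeze0 _ E).
  move=> n; rewrite L2nrm_ge0/=.
  have mda : measurable_fun D (fun x => a n x - f x) by exact: measurable_funB.
  have mdb : measurable_fun D (fun x => b n x - g x) by exact: measurable_funB.
  have sda : sqint (fun x => (a n x - f x) ^+ 2) by exact: sqint_sqrB.
  have sdb : sqint (fun x => (b n x - g x) ^+ 2) by exact: sqint_sqrB.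
  rewrite (_ : (fun x => _ - _) = (fun x => (a n x - f x) * (b n x - g x) +
      ((a n x - f x) * g x + f x * (b n x - g x)))).
    apply: le_trans (L2nrmD _ _) _; [exact: sqintM|by apply: sqintD; exact: sqintM|].
    apply: lerD; first exact: leM.
    by apply: le_trans (L2nrmD _ _) _; [exact: sqintM|exact: sqintM|];
      apply: lerD; exact: leM.
  by apply/funext => x; ring.
have cs (u : nat -> R) : u n @[n --> \oo] --> 0 ->
    Num.sqrt (u n) @[n --> \oo] --> 0.
  by rewrite -{2}[0]sqrtr0 => u0; apply: continuous_cvg => //; exact: sqrt_continuous.
rewrite -[X in _ --> X](_ : 0 + (0 + 0) = 0); last by rewrite !addr0.
apply: cvgD; first by apply: cs; rewrite -[X in _ --> X](mulr0 0); exact: cvgM.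
apply: cvgD; apply: cs.
  by rewrite -[X in _ --> X](mul0r (L2nrm (fun x => g x ^+ 2))); apply: cvgM => //; exact: cvg_cst.
by rewrite -[X in _ --> X](mulr0 (L2nrm (fun x => f x ^+ 2))); apply: cvgM => //; exact: cvg_cst.
Qed.

End square_integrable.

(** * Lower semicontinuity of the L^4 norm *)

Lemma ler_sqr_norm (R : realDomainType) (a b : R) : `|a| <= `|b| -> a ^+ 2 <= b ^+ 2.
Proof.
by move=> ab; rewrite -[leLHS]real_normK ?num_real// -[leRHS]real_normK ?num_real// lerXn2r ?nnegrE.
Qed.

Section fatou.
Context d (T : measurableType d) (R : realType).
Variables (mu : {measure set T -> \bar R}) (D : set T).
Hypothesis mD : measurable D.
Implicit Types f g h : T -> R.
Local Notation sqint := (sqint mu D).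
Local Notation L2nrm := (L2nrm mu D).

Lemma Rintegral_EFin f : rintegrable mu D f ->
  (\int[mu]_(x in D) (f x)%:E)%E = (\int[mu]_(x in D) f x)%:E.
Proof. by move=> iF; rewrite /Rintegral fineK//; exact: integrable_fin_num. Qed.

Let band g (K : nat) := D `&` [set x | `|g x| <= K%:R].

Let measurable_band g K : measurable_fun D g -> measurable (band g K).
Proof.
move=> mg; have := mg mD `[- K%:R, K%:R]%classic (measurable_itv _).
rewrite (_ : _ @^-1` _ = [set x | `|g x| <= K%:R])//.
by apply/seteqP; split=> x /=; rewrite in_itv/= ler_norml.
Qed.

(** Let t be the truncation of g. By convexity psi^4 >= t^4 + 4 t^3 (psi - t), and
    t^3 (psi - t) = t^3 (psi - g) because g = t wherever t is not zero. Since t is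
    bounded, t^3 is in L^2, so the integral of this last term tends to zero as
    psi tends to g in L^2. *)
Let truncated_quartic_le g C (K : nat) : sqint g ->
  (forall e, 0 < e -> exists psi, [/\ sqint psi, sqint (fun x => psi x ^+ 2),
     L2nrm (fun x => psi x ^+ 2) ^+ 2 <= C & L2nrm (fun x => psi x - g x) < e]) ->
  (\int[mu]_(x in band g K) ((g x ^+ 2) ^+ 2)%:E <= C%:E)%E.
Proof.
move=> sg apx; have [mg ig2] := sg.
have mF := measurable_band K mg.
pose t : T -> R := g \_ (band g K).
have mt : measurable_fun D t.
  by apply: measurable_funTS; apply/(measurable_restrictT g) => //; apply: measurable_funS mg => // x [].
have tE x : (t x = g x /\ `|t x| <= K%:R) \/ t x = 0.
  rewrite /t patchE; case: ifPn => [/[!inE] -[]|]; [by left|by right].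
have tK x : `|t x| <= K%:R by case: (tE x) => [[]//|->]; rewrite normr0.
have tg x : `|t x| <= `|g x| by case: (tE x) => [[->]//|->]; rewrite normr0.
have K0 : 0 <= K%:R :> R by [].
have st3 : sqint (fun x => t x ^+ 3).
  have := sqintZ mD (K%:R ^+ 2) sg => -[mKg iKg].
  split; first exact: measurable_funX.
  apply: (rintegrable_le mD _ iKg); first by do 2 apply: measurable_funX.
  move=> x _; rewrite ger0_norm ?sqr_ge0//.
  apply: ler_sqr_norm.
  rewrite (normrX 3) (normrM (K%:R ^+ 2)) (normrX 2) exprSr (ger0_norm K0) ler_pM//.
  by rewrite lerXn2r ?nnegrE.
have st2 : sqint (fun x => t x ^+ 2).
  have := sqintZ mD K%:R sg => -[mKg iKg].
  split; first exact: measurable_funX.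
  apply: (rintegrable_le mD _ iKg); first by do 2 apply: measurable_funX.
  move=> x _; rewrite ger0_norm ?sqr_ge0//.
  apply: ler_sqr_norm.
  by rewrite (normrX 2) (normrM K%:R) expr2 (ger0_norm K0) ler_pM.
have le_t4 : L2nrm (fun x => t x ^+ 2) ^+ 2 <= C.
  apply/ler_addgt0Pr => e e0.
  have [|psi [sp sp2 pC pe]] := apx (e / (4 * (L2nrm (fun x => t x ^+ 3) + 1))).
    by rewrite divr_gt0// mulr_gt0// ltr_wpDl ?L2nrm_ge0.
  have sd := sqintB mD sp sg.
  have ip4 := sp2.2; have it4 := st2.2.
  have id := sqint_rintegrableM mD st3 sd.
  have : 0 <= \int[mu]_(x in D) ((psi x ^+ 2) ^+ 2 - ((t x ^+ 2) ^+ 2 + 4 * (t x ^+ 3 * (psi x - g x)))).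
    apply: Rintegral_ge0 => x _.
    have -> : 4 * (t x ^+ 3 * (psi x - g x)) = 4 * (t x ^+ 3 * (psi x - t x)).
      by case: (tE x) => [[->]//|->]; rewrite expr0n/= !mul0r.
    rewrite (_ : _ - _ = (psi x - t x) ^+ 2 * ((psi x + t x) ^+ 2 + 2 * t x ^+ 2)).
      apply: mulr_ge0; first exact: sqr_ge0.
      by apply: addr_ge0; [exact: sqr_ge0|apply: mulr_ge0 => //; exact: sqr_ge0].
    by ring.
  rewrite RintegralB//; last by apply: rintegrableD => //; exact: rintegrableZ.
  rewrite RintegralD//; last exact: rintegrableZ.
  rewrite RintegralZl// -!sqr_L2nrm subr_ge0 => H.
  have := cauchy_schwarz mD st3 sd; rewrite ler_norml => /andP[CS _].
  have : L2nrm (fun x => t x ^+ 3) * L2nrm (fun x => psi x - g x) <= e / 4.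
    apply: (@le_trans _ _ ((L2nrm (fun x => t x ^+ 3) + 1) *
        (e / (4 * (L2nrm (fun x => t x ^+ 3) + 1))))).
      by apply: ler_pM; rewrite ?L2nrm_ge0 ?lerDl// ltW.
    rewrite le_eqVlt; apply/orP; left; apply/eqP; field.
    by rewrite gt_eqF// ltr_wpDl ?L2nrm_ge0.
  by move=> ?; lra.
apply: le_trans (_ : (\int[mu]_(x in D) ((t x ^+ 2) ^+ 2)%:E <= C%:E)%E).
  rewrite [leRHS](eq_integral (((fun x => ((g x ^+ 2) ^+ 2)%:E) \_ (band g K))%E)).
    by rewrite -integral_mkcondr setIA setIid.
  move=> x _; rewrite /t !patchE; case: ifP => // _; by rewrite !expr0n.
rewrite (Rintegral_EFin st2.2) lee_fin; rewrite sqr_L2nrm in le_t4; exact: le_t4.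
Qed.

(** The truncations of g satisfy the bound uniformly, and they increase to g:
    monotone convergence. *)
Lemma L4_lower_semicontinuous g C : sqint g ->
  (forall e, 0 < e -> exists psi, [/\ sqint psi, sqint (fun x => psi x ^+ 2),
     L2nrm (fun x => psi x ^+ 2) ^+ 2 <= C & L2nrm (fun x => psi x - g x) < e]) ->
  sqint (fun x => g x ^+ 2) /\ L2nrm (fun x => g x ^+ 2) ^+ 2 <= C.
Proof.
move=> sg apx; have [mg ig2] := sg.
have mg4 : measurable_fun D (fun x => (g x ^+ 2) ^+ 2) by do 2 apply: measurable_funX.
have F4 : (\int[mu]_(x in D) ((g x ^+ 2) ^+ 2)%:E <= C%:E)%E.
  have mgF K : measurable_fun (band g K) (fun x => ((g x ^+ 2) ^+ 2)%:E).
    by apply/measurable_EFinP; apply: measurable_funS mg4 => // x [].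
  have ndF : nondecreasing_seq (band g).
    move=> m n mn; apply/subsetPset => x [Dx /= gm]; split=> //=.
    by rewrite (le_trans gm)// ler_nat.
  have cF := ge0_nondecreasing_set_cvg_integral (mu := mu) ndF
    (fun K => measurable_band K mg) mgF (fun K x _ => sqr_ge0 (g x ^+ 2)).
  have DF : D = \bigcup_K band g K.
    apply/seteqP; split=> [x Dx|x [K _ []//]].
    exists (Num.bound `|g x|) => //; split=> //=.
    by apply/ltW; exact: archi_boundP.
  rewrite DF; apply: (cvge_to_le cF); apply: nearW => K.
  exact: truncated_quartic_le.
have ig4 : rintegrable mu D (fun x => (g x ^+ 2) ^+ 2).
  apply/integrableP; split; first exact/measurable_EFinP.
  under eq_integral do rewrite gee0_abs ?lee_fin ?sqr_ge0//.
  by apply: le_lt_trans F4 _; rewrite ltry.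
split; first by split=> //; exact: measurable_funX.
by rewrite sqr_L2nrm -lee_fin -Rintegral_EFin.
Qed.

Lemma L2_sqint f : f \_ D \in Lfun mu 2%:E <-> sqint f.
Proof.
split.
  move=> Lf; have H := Lfun2_integrable_sqr Lf.
  move: Lf; rewrite inE => /andP[/[!inE]/= mf _].
  split; first by apply/(measurable_restrictT f).
  apply/integrable_mkcond => //; apply: eq_integrable H => // x _ /=.
  by rewrite !patchE; case: ifP => //; rewrite expr0n.
move=> [mf if2]; rewrite inE; apply/andP; split; rewrite inE/=.
  exact/(measurable_restrictT f).
rewrite /finite_norm unlock /=.
apply: poweR_lty.
move/(integrable_mkcond _ mD) : if2 => /integrableP[_]; apply: le_lt_trans.
rewrite le_eqVlt; apply/orP; left; apply/eqP; apply: eq_integral => x _ /=.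
rewrite !patchE; case: ifP => _ /=; last by rewrite normr0 powR0.
by rewrite powR_mulrn// -normrX.
Qed.

Lemma L2nrm_ae_eq0 f : sqint f -> {ae mu, forall x, D x -> f x = 0} -> L2nrm f = 0.
Proof.
move=> [mf if2] f0.
have mf2 : measurable_fun D (EFin \o (fun x => f x ^+ 2)) by exact: measurable_int if2.
have /(ae_eq_integral_abs mu mD mf2) : ae_eq mu D (EFin \o (fun x => f x ^+ 2)) (cst 0%E).
  by apply: filterS f0 => x fx0 Dx /=; rewrite fx0// expr0n.
under eq_integral do rewrite gee0_abs ?lee_fin ?sqr_ge0//.
by rewrite /L2nrm /Rintegral => ->; rewrite sqrtr0.
Qed.

End fatou.

(** * Lebesgue measure on row vectors *)

Section borel_rV.
Context {R : realType}.

Lemma measurable_ball_rV n (x : 'rV[R]_n) (e : R) : 0 < e -> measurable (ball x e).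
Proof.
move=> e0; rewrite (_ : ball x e = \bigcap_(i in [set: 'I_n])
    ((fun y : 'rV[R]_n => y ord0 i) @^-1` ball (x ord0 i) e)).
  apply: fin_bigcap_measurable => // i _; rewrite -[X in measurable X]setTI.
  by apply: measurable_coord => //; exact: measurable_ball.
apply/seteqP; split=> [y [_ xy] i _|y xy]; first exact: xy.
by split=> // i j; rewrite ord1; exact: xy.
Qed.

(** A ball of the max norm is a box, so it belongs to the sigma-algebra generated
    by the coordinates; an open set is the union of the balls with rational
    centre and radius that it contains. *)
Lemma open_measurable_rV n (U : set 'rV[R]_n) : open U -> measurable U.
Proof.
move=> oU.
pose good (p : 'rV[rat]_n * rat) : bool := (0 < p.2) &&
  `[< ball (map_mx ratr p.1 : 'rV[R]_n) (ratr p.2) `<=` U >].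
rewrite (_ : U = \bigcup_p (if good p then
    ball (map_mx ratr p.1 : 'rV[R]_n) (ratr p.2) else set0)).
  apply: countable_bigcupT_measurable => [|p]; first exact: countableP.
  case: ifP => // /andP[p0 _]; apply: measurable_ball_rV.
  by rewrite ltr0q.
apply/seteqP; split=> [x Ux|x [p _]]; last first.
  by case: ifP => // /andP[_ /asboolP]; exact.
have /nbhs_ballP[e /= e0 eU] : nbhs x U by exact: open_nbhs_nbhs.
have [q /andP[q0 qe]] : exists q : rat, 0 < (ratr q : R) < e / 2.
  by have [//|q] := @rat_in_itvoo R 0 (e / 2); rewrite ?divr_gt0// in_itv/=; exists q.
have /choice[c cP] (i : 'I_n) : exists c : rat, ball (x ord0 i) (ratr q) (ratr c).
  have [|c] := @rat_in_itvoo R (x ord0 i - ratr q) (x ord0 i + ratr q); first by lra.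
  by rewrite in_itv/= => /andP[? ?]; exists c; rewrite /ball/= ltr_norml; lra.
exists (\row_i c i, q) => //; rewrite ifT /=.
  by split=> // i j; rewrite ord1 !mxE; apply/ball_sym/cP.
apply/andP; split=> /=; first by rewrite -(@ltr0q R).
apply/asboolP => y [_ cy]; apply: eU; split=> // i j; rewrite ord1.
have := cy ord0 j; rewrite !mxE => /(ball_triangle (cP j)); apply: le_ball; lra.
Qed.

Lemma continuous_measurable_rV n (f : 'rV[R]_n -> R) :
  continuous f -> measurable_fun setT f.
Proof.
move=> cf; apply: (measurability _ (RGenOpens.measurableE R)).
move=> _ [_ [a [b ->]] <-]; rewrite setTI; apply: open_measurable_rV.
by move: cf => /continuousP; apply; exact: interval_open.
Qed.

End borel_rV.

Section fubini_rV.
Context {R : realType} (n : nat).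
Local Notation mu := (@lebesgue_measure R).
Local Notation cons_ a y := (rV_cons (a, y)).
Local Open Scope ereal_scope.

Let mcons : measurable_fun setT
  (@rV_cons R n : measurableTypeR R * 'rV[R]_n -> 'rV[R]_n.+1).
Proof. exact: measurable_rV_cons. Qed.

Let integral_rV_pushforward (F : 'rV[R]_n.+1 -> \bar R) :
  measurable_fun setT F -> (forall x, 0 <= F x) ->
  \int[lebesgue_rV n.+1]_x F x =
  \int[mu \x lebesgue_rV n]_(p in @rV_cons R n @^-1` setT) F (rV_cons p).
Proof.
move=> mF F0.
pose P := mu \x lebesgue_rV n.
transitivity (\int[pushforward P (@rV_cons R n)]_(y in setT) F y) => //.
by rewrite (ge0_integral_pushforward mcons P measurableT mF (fun x _ => F0 x)).
Qed.

Lemma ge0_integral_rV_consl (F : 'rV[R]_n.+1 -> \bar R) :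
  measurable_fun setT F -> (forall x, 0 <= F x) ->
  \int[lebesgue_rV n.+1]_x F x = \int[mu]_a \int[lebesgue_rV n]_y F (cons_ a y).
Proof.
move=> mF F0.
rewrite integral_rV_pushforward// preimage_setT fubini_tonelli1//=.
by apply: measurableT_comp => //; exact: mcons.
Qed.

Lemma ge0_integral_rV_consr (F : 'rV[R]_n.+1 -> \bar R) :
  measurable_fun setT F -> (forall x, 0 <= F x) ->
  \int[lebesgue_rV n.+1]_x F x = \int[lebesgue_rV n]_y \int[mu]_a F (cons_ a y).
Proof.
move=> mF F0.
rewrite integral_rV_pushforward// preimage_setT fubini_tonelli2//=.
by apply: measurableT_comp => //; exact: mcons.
Qed.

Let integrable_cons (F : 'rV[R]_n.+1 -> \bar R) :
  (lebesgue_rV n.+1).-integrable setT F ->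
  (mu \x lebesgue_rV n).-integrable setT (F \o @rV_cons R n).
Proof.
move=> /integrableP[mF iF]; apply/integrableP; split.
  by apply: measurableT_comp => //; exact: mcons.
move: iF; rewrite integral_rV_pushforward ?preimage_setT//.
by apply: measurableT_comp => //; exact: mF.
Qed.

Lemma integral_rV_consl (F : 'rV[R]_n.+1 -> \bar R) :
  (lebesgue_rV n.+1).-integrable setT F ->
  \int[lebesgue_rV n.+1]_x F x = \int[mu]_a \int[lebesgue_rV n]_y F (cons_ a y).
Proof.
move=> iF; have iFc := integrable_cons iF; have mF := measurable_int _ iF.
pose P := mu \x lebesgue_rV n.
transitivity (\int[pushforward P (@rV_cons R n)]_(y in setT) F y) => //.
rewrite (integral_pushforward (mu := P) mcons mF _ measurableT) ?preimage_setT//.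
by rewrite -integral12_prod_meas1.
Qed.

Lemma integral_rV_consr (F : 'rV[R]_n.+1 -> \bar R) :
  (lebesgue_rV n.+1).-integrable setT F ->
  \int[lebesgue_rV n.+1]_x F x = \int[lebesgue_rV n]_y \int[mu]_a F (cons_ a y).
Proof.
move=> iF; have iFc := integrable_cons iF; have mF := measurable_int _ iF.
pose P := mu \x lebesgue_rV n.
transitivity (\int[pushforward P (@rV_cons R n)]_(y in setT) F y) => //.
rewrite (integral_pushforward (mu := P) mcons mF _ measurableT) ?preimage_setT//.
by rewrite -integral21_prod_meas1.
Qed.

Lemma measurable_rV_cons_inner (F : 'rV[R]_n.+1 -> \bar R) :
  measurable_fun setT F -> (forall x, 0 <= F x) ->
  measurable_fun setT (fun a => \int[lebesgue_rV n]_y F (cons_ a y)).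
Proof.
move=> mF F0.
apply: (measurable_fun_fubini_tonelli_F (F \o @rV_cons R n)) => //=.
by apply: measurableT_comp => //; exact: mcons.
Qed.

Lemma measurable_rV_cons_outer (F : 'rV[R]_n.+1 -> \bar R) :
  measurable_fun setT F -> (forall x, 0 <= F x) ->
  measurable_fun setT (fun y => \int[mu]_a F (cons_ a y)).
Proof.
move=> mF F0.
apply: (measurable_fun_fubini_tonelli_G (m1 := mu) (F \o @rV_cons R n)) => //=.
by apply: measurableT_comp => //; exact: mcons.
Qed.

End fubini_rV.

(** * Compactly supported C^1 functions and their slices *)

Section line.
Context {R : realType}.
Local Notation mu := (@lebesgue_measure R).
Variables (h : R -> R) (L : R).
Hypotheses (dh : forall x, derivable h x 1) (ch' : continuous (derive1 h)).
Hypothesis h0 : forall x, L < `|x| -> h x = 0.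

Let ch : continuous h.
Proof. by move=> x; apply: differentiable_continuous; apply/derivable1_diffP. Qed.

Lemma integral_derive1_itv (a b : R) : a < b ->
  (\int[mu]_(x in `[a, b]) (derive1 h x)%:E = (h b - h a)%:E)%E.
Proof.
move=> ab; rewrite EFinB; apply: continuous_FTC2 => //.
- by apply: continuous_subspaceT => x; exact: ch'.
- split=> [x _||]; first exact: dh.
  + by apply: cvg_at_right_filter; exact: ch.
  + by apply: cvg_at_left_filter; exact: ch.
Qed.

Lemma derive1_supp x : L < `|x| -> derive1 h x = 0.
Proof.
move=> Lx.
have : \forall y \near x, L < `|y|.
  exact: (cvgr_gt _ (@norm_continuous _ R x) _ Lx).
move=> nx; have {nx} : \forall y \near x, h y = cst 0 y by apply: filterS nx => y /h0.
move/(@near_eq_derive _ R R h (cst 0) x 1); rewrite derive1E => ->.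
by rewrite derive_cst.
Qed.

Lemma integral_derive1_eq0 : (\int[mu]_x (derive1 h x)%:E = 0)%E.
Proof.
pose N : R := `|L| + 1.
have LN : L < `|N| by rewrite /N [`|_ + 1|]ger0_norm ?addr_ge0// (le_lt_trans (ler_norm _))// ltrDl.
have N0 : 0 < N by rewrite /N ltr_wpDl.
have NN : - N < N by rewrite gtrN.
transitivity (\int[mu]_(x in `[(- N)%R, N]) (derive1 h x)%:E)%E; last first.
  by rewrite (integral_derive1_itv NN) !h0 ?normrN// subrr.
rewrite [RHS]integral_mkcond; apply: eq_integral => x _.
rewrite patchE; case: ifPn => //; rewrite notin_setE/= in_itv/= -ler_norml => /negP.
rewrite -ltNge => Nx; rewrite derive1_supp// (le_lt_trans _ Nx)// /N.
by rewrite (le_trans (ler_norm _))// lerDl.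
Qed.

(** Integrate the derivative from a point outside the support up to x. *)
Lemma le_integral_derive1 x : (`|h x|%:E <= \int[mu]_x `|derive1 h x|%:E)%E.
Proof.
pose N : R := `|L| + `|x| + 1.
have LN : L < `|- N|.
  rewrite normrN /N ger0_norm ?addr_ge0// (le_lt_trans (ler_norm _))// -addrA ltrDl.
  by rewrite ltr_wpDl.
have Nx : - N < x.
  have := ler_norm (- x); rewrite normrN => xx; have := normr_ge0 L; rewrite /N; lra.
have mh' : measurable_fun setT (EFin \o (derive1 h)).
  by apply/measurable_EFinP; exact: continuous_measurable_fun.
have := integral_derive1_itv Nx; rewrite [h (- N)]h0// subr0 => hx.
rewrite -[leLHS]/(`|(h x)%:E|%E) -hx.
apply: le_trans (le_abse_integral _ _ _) _ => //.
  exact: measurable_funTS.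
apply: ge0_subset_integral => //.
exact: measurableT_comp.
Qed.

End line.

Section slices.
Context {R : realType}.

(** A directional derivative only depends on the function along the line. It is
    stated for two spaces so that a function can be compared with its slices. *)
Lemma eq_derivable_along (V W : normedModType R) (f : V -> R) (g : W -> R) x v z w :
  (forall h : R, f (h *: v + x) = g (h *: w + z)) ->
  derivable f x v = derivable g z w /\ 'D_v f x = 'D_w g z.
Proof.
move=> fg; rewrite /derivable /derive.
have fgx : f x = g z by have := fg 0; rewrite !scale0r !add0r.
rewrite (_ : (fun h : R => h^-1 *: ((f \o shift x) (h *: v) - f x)) =
             (fun h : R => h^-1 *: ((g \o shift z) (h *: w) - g z)))//.
by apply/funext => h /=; rewrite fg fgx.
Qed.

Variable n : nat.
Local Notation cons_ a y := (@rV_cons R n (a, y)).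

Lemma rV_cons_delta0 (s a : R) (y : 'rV[R]_n) :
  cons_ (s *: 1 + a) y = s *: delta_mx ord0 ord0 + cons_ a y.
Proof.
apply/rowP => i; rewrite !mxE eqxx/=.
case: unliftP => [j ->|->]; last by rewrite eqxx.
by rewrite (_ : lift ord0 j == ord0 = false)// mulr0 add0r.
Qed.

Lemma rV_cons_delta_lift (s a : R) (y : 'rV[R]_n) j :
  cons_ a (s *: delta_mx ord0 j + y) = s *: delta_mx ord0 (lift ord0 j) + cons_ a y.
Proof.
apply/rowP => i; rewrite !mxE eqxx/=.
case: unliftP => [k ->|->]; first by rewrite !mxE eqxx/= (inj_eq lift_inj).
by rewrite (_ : ord0 == lift ord0 j = false)// mulr0 add0r.
Qed.

Lemma continuous_rV_cons1 (y : 'rV[R]_n) : continuous (fun a => cons_ a y).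
Proof.
move=> a; apply/cvg_ballP => e e0; near=> b; split=> // i j; rewrite !mxE.
case: unlift => [k|] /=; first exact: ballxx.
by near: b; exact: (nbhsx_ballx a e e0).
Unshelve. all: by end_near. Qed.

Lemma continuous_rV_cons2 (a : R) : continuous (fun y : 'rV[R]_n => cons_ a y).
Proof.
move=> y A /nbhs_ballP[e /= e0 eA]; apply/(nbhs_ballP y).
exists e => //= z [_ yz]; apply: eA.
by split=> // i j; rewrite !mxE; case: unlift => [k|] /=; [exact: yz|exact: ballxx].
Qed.

End slices.

Section C1_compact.
Context {R : realType}.

(** The support condition is stated coordinatewise because in that form it
    passes to the slices of phi obtained by fixing the first coordinate. *)
Definition C1_compact n (phi : 'rV[R]_n -> R) :=
  [/\ continuous phi, forall i x, derivable phi x (delta_mx ord0 i),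
    forall i, continuous (partial i phi)
    & exists L : R, forall (x : 'rV[R]_n) i, L < `|x ord0 i| -> phi x = 0].

Section slice.
Variables (n : nat) (phi : 'rV[R]_n.+1 -> R).
Hypothesis Cphi : C1_compact phi.
Local Notation cons_ a y := (@rV_cons R n (a, y)).

Lemma slice_line (y : 'rV[R]_n) (h := fun a => phi (cons_ a y)) :
  [/\ forall a, derivable h a 1, continuous (derive1 h),
     (forall a, derive1 h a = partial ord0 phi (cons_ a y)) &
     exists L : R, forall a, L < `|a| -> h a = 0].
Proof.
have [cphi dphi cdphi [L phi0]] := Cphi.
have E a : derivable h a 1 = derivable phi (cons_ a y) (delta_mx ord0 ord0) /\
           'D_1 h a = 'D_(delta_mx ord0 ord0) phi (cons_ a y).
  by apply: eq_derivable_along => s; rewrite /h rV_cons_delta0.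
have h'E a : derive1 h a = partial ord0 phi (cons_ a y) by rewrite derive1E (E a).2.
split=> //.
- by move=> a; rewrite (E a).1; exact: dphi.
- rewrite (funext h'E) => a.
  by apply: (continuous_comp (@continuous_rV_cons1 _ _ y a)); exact: cdphi.
- by exists L => a La; apply: (phi0 _ ord0); rewrite mxE unlift_none.
Qed.

Lemma slice_partial (a : R) j y :
  partial j (fun y => phi (cons_ a y)) y = partial (lift ord0 j) phi (cons_ a y).
Proof.
by apply: (eq_derivable_along _).2 => s; rewrite rV_cons_delta_lift.
Qed.

Lemma slice_C1_compact (a : R) : C1_compact (fun y => phi (cons_ a y)).
Proof.
have [cphi dphi cdphi [L phi0]] := Cphi; split.
- by move=> y; apply: (continuous_comp (@continuous_rV_cons2 _ _ a y)); exact: cphi.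
- move=> j y; rewrite (eq_derivable_along (g := phi) (z := cons_ a y)
    (w := delta_mx ord0 (lift ord0 j)) _).1; first exact: dphi.
  by move=> s; rewrite rV_cons_delta_lift.
- move=> j; rewrite (funext (slice_partial a j)) => y.
  by apply: (continuous_comp (@continuous_rV_cons2 _ _ a y)); exact: cdphi.
- by exists L => y j Ly; apply: (phi0 _ (lift ord0 j)); rewrite mxE liftK.
Qed.

End slice.
End C1_compact.

Section pointwise_derivatives.
Context {R : realType} {V : normedModType R}.
Implicit Types (f g : V -> R) (x v : V).

Lemma derivable_mul f g x v : derivable f x v -> derivable g x v ->
  derivable (fun y => f y * g y) x v /\
  'D_v (fun y => f y * g y) x = f x * 'D_v g x + g x * 'D_v f x.
Proof. by move=> df dg; split; [exact: (derivableM df dg)|exact: (deriveM df dg)]. Qed.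

Lemma derivable_lin a b f g x v : derivable f x v -> derivable g x v ->
  derivable (fun y => a * f y + b * g y) x v /\
  'D_v (fun y => a * f y + b * g y) x = a * 'D_v f x + b * 'D_v g x.
Proof.
move=> df dg; have da := derivableZ (k := a) df; have db := derivableZ (k := b) dg.
split; first exact: (derivableD da db).
by rewrite [LHS](deriveD da db) !deriveZ.
Qed.

End pointwise_derivatives.

(** * The Sobolev inequality in dimensions two and three *)

Section compact_support_integrals.
Context {R : realType}.
Local Notation lmu := (@lebesgue_measure R).

Lemma rintegrable_continuous_supp n (f : 'rV[R]_n -> R) (L : R) : continuous f ->
  (forall (x : 'rV[R]_n) i, L < `|x ord0 i| -> f x = 0) ->
  rintegrable (lebesgue_rV n) setT f.
Proof.
move=> cf f0.
pose box := [set x : 'rV[R]_n | forall i, `[- L, L]%classic (x ord0 i)].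
have cbox : compact box.
  by apply: (@rV_compact _ _ (fun=> `[- L, L]%classic)) => i; exact: segment_compact.
have mbox : measurable box.
  rewrite (_ : box = \bigcap_(i in [set: 'I_n])
      ((fun x : 'rV[R]_n => x ord0 i) @^-1` `[- L, L])).
    apply: fin_bigcap_measurable => // i _; rewrite -[X in measurable X]setTI.
    by apply: measurable_coord => //; exact: measurable_itv.
  by apply/seteqP; split=> [x bx i _|x bx i]; exact: bx.
have fbox : (lebesgue_rV n box < +oo)%E.
  rewrite (@lebesgue_rV_box R n (fun=> `[- L, L]%classic)); last by move=> i; exact: measurable_itv.
  rewrite -ge0_fin_numE; last first.
    by apply: prode_ge0 => i _; exact: measure_ge0.
  apply: (big_ind (fun e : \bar R => e \is a fin_num)) => [|x y|i _] //; first exact: fin_numM.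
  by rewrite lebesgue_measure_itv/= lte_fin; case: ifP.
have mf := continuous_measurable_rV cf.
have ibox : (lebesgue_rV n).-integrable box (EFin \o f).
  apply: measurable_bounded_integrable => //; first exact: measurable_funTS.
  have : compact (f @` box) by apply: continuous_compact => //; exact: continuous_subspaceT.
  by move/compact_bounded; rewrite /bounded_set /bounded_near => -[M [Mr H]];
    exists M; split=> // x Mx y By; apply: H => //; exists y.
rewrite /rintegrable (_ : EFin \o f = (EFin \o f) \_ box); first exact/(integrable_mkcond _ mbox).
apply/funext => x; rewrite patchE; case: ifPn => //.
rewrite notin_setE /box/= => /existsNP[i]; rewrite in_itv/= -ler_norml => /negP.
by rewrite -ltNge => /f0 ->.
Qed.

Lemma integral_rV0 (F : 'rV[R]_0 -> \bar R) z : measurable_fun setT F ->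
  (\int[lebesgue_rV 0]_y F y = F z)%E.
Proof.
move=> mF; rewrite /= integral_dirac// diracT mul1e; congr F.
by apply/rowP => -[].
Qed.

(** The fundamental theorem of calculus for phi^2 along the first coordinate; the
    bound no longer depends on a. *)
Lemma C1_compact_sqr_le n (phi : 'rV[R]_n.+1 -> R) a y : C1_compact phi ->
  (((phi (rV_cons (a, y))) ^+ 2)%:E <=
   \int[lmu]_b `|2 * phi (rV_cons (b, y)) * partial ord0 phi (rV_cons (b, y))|%:E)%E.
Proof.
move=> Cphi; have [dh ch' h'E [L h0]] := slice_line Cphi y.
set h := fun _ => _ in dh ch' h'E h0.
have ch : continuous h.
  by move=> x; apply: differentiable_continuous; apply/derivable1_diffP.
pose h2 x := h x * h x.
have dh2 x : derivable h2 x 1 by have [] := derivable_mul (dh x) (dh x).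
have h2'E x : derive1 h2 x = 2 * h x * derive1 h x.
  by rewrite !derive1E (derivable_mul (dh x) (dh x)).2; ring.
have ch2' : continuous (derive1 h2).
  rewrite (funext h2'E) => x.
  by apply: cvgM; [apply: cvgM; [exact: cvg_cst|exact: ch]|exact: ch'].
have h20 x : L < `|x| -> h2 x = 0 by move=> Lx; rewrite /h2 (_ : h x = 0) ?mulr0//; exact: h0.
have := le_integral_derive1 dh2 ch2' h20 a.
rewrite /h2 -expr2 ger0_norm ?sqr_ge0// => /le_trans; apply.
rewrite le_eqVlt; apply/orP; left; apply/eqP; apply: eq_integral => x _.
by rewrite h2'E h'E.
Qed.

Lemma partial_supp n (phi : 'rV[R]_n -> R) (L : R) j :
  (forall (x : 'rV[R]_n) i, L < `|x ord0 i| -> phi x = 0) ->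
  forall (x : 'rV[R]_n) i, L < `|x ord0 i| -> partial j phi x = 0.
Proof.
move=> phi0 x i Lx.
pose c (y : 'rV[R]_n) : R := `|y ord0 i|.
have cn : c y @[y --> x] --> c x.
  by apply: (continuous_comp (@coord_continuous _ _ _ ord0 i x)); exact: norm_continuous.
have nx : \forall y \near x, L < c y by exact: (cvgr_gt _ cn _ Lx).
have {}nx : \forall y \near x, phi y = cst 0 y.
  by apply: filterS nx => y /phi0.
by rewrite /partial (near_eq_derive _ nx) derive_cst.
Qed.

Lemma rintegrable_partial n i (phi : 'rV[R]_n -> R) : C1_compact phi ->
  rintegrable (lebesgue_rV n) setT (partial i phi).
Proof.
by move=> [_ _ cdphi [L /partial_supp phi0]]; exact: (rintegrable_continuous_supp _ (phi0 i)).
Qed.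

(** Fubini reduces the statement to the line in direction i, where the
    derivative of a compactly supported function integrates to zero. *)
Lemma integral_partial_eq0 n i (phi : 'rV[R]_n -> R) : C1_compact phi ->
  (\int[lebesgue_rV n]_x (partial i phi x)%:E = 0)%E.
Proof.
elim: n i phi => [[]//|n IHn] i phi Cphi.
have Fi : rintegrable (lebesgue_rV n.+1) setT (partial i phi) by exact: rintegrable_partial.
case: (unliftP ord0 i) Fi => [j|] -> Fi.
  rewrite integral_rV_consl//; apply: integral0_eq => a _.
  rewrite -(IHn j _ (slice_C1_compact Cphi a)); apply: eq_integral => y _.
  by rewrite slice_partial.
rewrite integral_rV_consr//; apply: integral0_eq => y _.
have [dh ch' h'E [L h0]] := slice_line Cphi y.
rewrite -[RHS](integral_derive1_eq0 dh ch' h0); apply: eq_integral => a _.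
by rewrite h'E.
Qed.

Lemma C1_compact_measurable n (phi : 'rV[R]_n -> R) : C1_compact phi ->
  measurable_fun setT phi /\ forall i, measurable_fun setT (partial i phi).
Proof.
by move=> [cphi _ cdphi _]; split=> [|i]; apply: continuous_measurable_rV.
Qed.

Lemma C1_compact_sqint n (phi : 'rV[R]_n -> R) : C1_compact phi ->
  [/\ sqint (lebesgue_rV n) setT phi, sqint (lebesgue_rV n) setT (fun x => phi x ^+ 2)
    & forall i, sqint (lebesgue_rV n) setT (partial i phi)].
Proof.
move=> Cphi; have [mphi mdphi] := C1_compact_measurable Cphi.
have [cphi _ cdphi [L phi0]] := Cphi.
have cX (f : 'rV[R]_n -> R) m : continuous f -> continuous (fun x => f x ^+ m).
  move=> cf x; exact: (continuous_comp (cf x) (@exprn_continuous _ m (f x))).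
split=> [||i]; split=> //; try exact: measurable_funX.
- by apply: (rintegrable_continuous_supp (L := L)) (cX _ _ cphi) _ => x i /phi0 ->; rewrite expr0n.
- apply: (rintegrable_continuous_supp (L := L)) (cX _ _ (cX _ _ cphi)) _ => x i /phi0 ->.
  by rewrite !expr0n.
- apply: (rintegrable_continuous_supp (L := L)) (cX _ _ (cdphi i)) _ => x j.
  by move=> Lx; rewrite (partial_supp i phi0 Lx) expr0n.
Qed.

Let dsqr n (phi : 'rV[R]_n -> R) i : 'rV[R]_n -> \bar R :=
  fun x => `|2 * phi x * partial i phi x|%:E.

Let measurable_dsqr n (phi : 'rV[R]_n -> R) i : C1_compact phi ->
  measurable_fun setT (dsqr phi i).
Proof.
move=> /C1_compact_measurable[mphi mdphi].
apply/measurable_EFinP; apply: measurableT_comp => //.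
by apply: measurable_funM => //; apply: measurable_funM => //; exact: measurable_cst.
Qed.

Let dsqr_ge0 n (phi : 'rV[R]_n -> R) i x : (0 <= dsqr phi i x)%E.
Proof. by rewrite lee_fin. Qed.

Lemma C1_compact_sqr_le_rV1 (phi : 'rV[R]_1 -> R) y : C1_compact phi ->
  ((phi y ^+ 2)%:E <= \int[lebesgue_rV 1]_x dsqr phi ord0 x)%E.
Proof.
move=> Cphi; rewrite ge0_integral_rV_consl//; last exact: measurable_dsqr.
rewrite -(rV_unconsK y); apply: le_trans (C1_compact_sqr_le _ _ Cphi) _.
rewrite le_eqVlt; apply/orP; left; apply/eqP; apply: eq_integral => b _.
rewrite (@integral_rV0 _ (rV_uncons y).2)//.
apply: measurableT_comp; first exact: measurable_dsqr.
apply/measurable_fun_rVP => i; rewrite /rV_cons; under eq_fun do rewrite mxE.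
case: unlift => [j|] /=; [exact: measurable_coord|exact: measurable_cst].
Qed.

(** phi^2 at (a, y) is bounded by a function g of y alone, and also by a function
    h of a alone. Hence phi^4 <= g h, and the integral of the product factors. *)
Lemma integral_quartic_le_rV2 (phi : 'rV[R]_2 -> R) : C1_compact phi ->
  (\int[lebesgue_rV 2]_x ((phi x ^+ 2) ^+ 2)%:E <=
   (\int[lebesgue_rV 2]_x dsqr phi ord0 x) *
   (\int[lebesgue_rV 2]_x dsqr phi (lift ord0 ord0) x))%E.
Proof.
move=> Cphi; have [mphi mdphi] := C1_compact_measurable Cphi.
have md i := measurable_dsqr i Cphi.
have m4 : measurable_fun setT (fun x => ((phi x ^+ 2) ^+ 2)%:E).
  by apply/measurable_EFinP; do 2 apply: measurable_funX.
pose g y := (\int[lmu]_b dsqr phi ord0 (rV_cons (b, y)))%E.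
pose h a := (\int[lebesgue_rV 1]_y dsqr phi (lift ord0 ord0) (rV_cons (a, y)))%E.
have mg : measurable_fun setT g by exact: measurable_rV_cons_outer.
have mh : measurable_fun setT h by exact: measurable_rV_cons_inner.
have g0 y : (0 <= g y)%E by exact: integral_ge0.
have h0 a : (0 <= h a)%E by exact: integral_ge0.
rewrite ge0_integral_rV_consl//; last by move=> x; rewrite lee_fin sqr_ge0.
rewrite [X in (_ <= X * _)%E]ge0_integral_rV_consr//.
rewrite [X in (_ <= _ * X)%E]ge0_integral_rV_consl//.
rewrite -/(\int[lebesgue_rV 1]_y g y)%E -/(\int[lmu]_a h a)%E.
have K0 : (0 <= \int[lebesgue_rV 1]_y g y)%E by exact: integral_ge0.
rewrite -(ge0_integralZl lmu measurableT mh (fun a _ => h0 a) K0).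
apply: ge0_le_integral => //.
- by move=> a _; apply: integral_ge0 => y _; rewrite lee_fin sqr_ge0.
- by apply: (measurable_rV_cons_inner m4) => x; rewrite lee_fin sqr_ge0.
- by apply: measurable_funeM.
move=> a _; rewrite -ge0_integralZr//.
apply: ge0_le_integral => //.
- by move=> y _; rewrite lee_fin sqr_ge0.
- have [mps _] := C1_compact_measurable (slice_C1_compact Cphi a).
  by apply/measurable_EFinP; do 2 apply: measurable_funX.
- by under eq_fun do rewrite muleC; exact: measurable_funeM.
move=> y _; rewrite expr2 EFinM; apply: lee_pmul; rewrite ?lee_fin ?sqr_ge0//.
  exact: C1_compact_sqr_le.
apply: le_trans (C1_compact_sqr_le_rV1 y (slice_C1_compact Cphi a)) _.
rewrite le_eqVlt; apply/orP; left; apply/eqP; apply: eq_integral => z _.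
by rewrite /dsqr slice_partial.
Qed.

Local Notation L2T n f := (L2nrm (lebesgue_rV n) setT f).

(** Cauchy-Schwarz, applied to absolute values. *)
Let integral_dsqr n (phi : 'rV[R]_n -> R) i : C1_compact phi ->
  (\int[lebesgue_rV n]_x dsqr phi i x <= (2 * (L2T n phi * L2T n (partial i phi)))%:E)%E.
Proof.
move=> Cphi; have [s1 s2 ds] := C1_compact_sqint Cphi.
have sa (f : 'rV[R]_n -> R) : sqint (lebesgue_rV n) setT f -> sqint (lebesgue_rV n) setT (fun x => `|f x|).
  move=> [mf if2]; split; first exact: measurableT_comp.
  by under eq_fun do rewrite real_normK ?num_real//.
have La (f : 'rV[R]_n -> R) : L2T n (fun x => `|f x|) = L2T n f.
  by congr Num.sqrt; apply: eq_Rintegral => x _; rewrite real_normK ?num_real.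
have iM := sqint_rintegrableM measurableT (sa _ s1) (sa _ (ds i)).
rewrite (eq_integral (fun x => (2 * (`|phi x| * `|partial i phi x|))%:E)); last first.
  by move=> x _; rewrite /dsqr !normrM mulrA [`|2|]ger0_norm.
rewrite (@Rintegral_EFin _ _ _ _ _ measurableT); last exact: rintegrableZ.
rewrite lee_fin RintegralZl// ler_pM2l// -La -[X in _ <= _ * X]La.
apply: le_trans (cauchy_schwarz measurableT (sa _ s1) (sa _ (ds i))); exact: ler_norm.
Qed.

Let le_sum2 n (phi : 'rV[R]_n -> R) i j : i != j ->
  L2T n (partial i phi) ^+ 2 + L2T n (partial j phi) ^+ 2 <=
  \sum_l L2T n (partial l phi) ^+ 2.
Proof.
move=> ij; rewrite (bigD1 i)//= (bigD1 j)/=; last by rewrite eq_sym.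
by rewrite addrA lerDl sumr_ge0// => l _; exact: sqr_ge0.
Qed.

Lemma ladyzhenskaya_rV2 (phi : 'rV[R]_2 -> R) : C1_compact phi ->
  (\int[lebesgue_rV 2]_x ((phi x ^+ 2) ^+ 2)%:E <=
   (2 * L2T 2 phi ^+ 2 * \sum_i L2T 2 (partial i phi) ^+ 2)%:E)%E.
Proof.
move=> Cphi; apply: le_trans (integral_quartic_le_rV2 Cphi) _.
have I i := integral_dsqr i Cphi.
have D0 i : (0 <= \int[lebesgue_rV 2]_x dsqr phi i x)%E by exact: integral_ge0.
apply: (le_trans (lee_pmul (D0 ord0) (D0 _) (I ord0) (I _))).
rewrite -EFinM lee_fin.
have am_gm (a b c S : R) : b ^+ 2 + c ^+ 2 <= S ->
    2 * (a * b) * (2 * (a * c)) <= 2 * a ^+ 2 * S.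
  move=> bcS; rewrite (_ : _ * _ * _ = 2 * a ^+ 2 * (2 * (b * c))); last ring.
  apply: ler_wpM2l; first by rewrite mulr_ge0// sqr_ge0.
  by apply: le_trans bcS; rewrite -subr_ge0 (_ : _ - _ = (b - c) ^+ 2) ?sqr_ge0//; ring.
by apply: am_gm; exact: (@le_sum2 _ phi ord0 (lift ord0 ord0) isT).
Qed.

(** Integrating [C1_compact_sqr_le] over a slice gives a bound uniform in the
    position a of the slice. It is the device that lifts the planar inequality
    to space. *)
Lemma L2nrm_slice_le n (phi : 'rV[R]_n.+1 -> R) a : C1_compact phi ->
  L2T n (fun y => phi (rV_cons (a, y))) ^+ 2 <=
  2 * (L2T n.+1 phi * L2T n.+1 (partial ord0 phi)).
Proof.
move=> Cphi; have [s1 _ _] := C1_compact_sqint (slice_C1_compact Cphi a).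
rewrite sqr_L2nrm -lee_fin -Rintegral_EFin//; last exact: s1.2.
apply: le_trans (integral_dsqr ord0 Cphi).
rewrite ge0_integral_rV_consr//; last exact: measurable_dsqr.
apply: ge0_le_integral => //.
- by move=> y _; rewrite lee_fin sqr_ge0.
- by apply/measurable_EFinP; apply: measurable_funX; exact: s1.1.
- by apply: measurable_rV_cons_outer => //; exact: measurable_dsqr.
- by move=> y _; exact: C1_compact_sqr_le.
Qed.

(** Integrate the planar inequality over the slices: the factor with the L^2
    norm of phi is bounded by [L2nrm_slice_le], and the one with the derivatives
    integrates to their norms over the whole space. *)
Lemma ladyzhenskaya_rV3 (phi : 'rV[R]_3 -> R) : C1_compact phi ->
  (\int[lebesgue_rV 3]_x ((phi x ^+ 2) ^+ 2)%:E <=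
   (4 * (L2T 3 phi * L2T 3 (partial ord0 phi)) *
    \sum_(j < 2) L2T 3 (partial (lift ord0 j) phi) ^+ 2)%:E)%E.
Proof.
move=> Cphi; have [mphi mdphi] := C1_compact_measurable Cphi.
have [s1 _ ds] := C1_compact_sqint Cphi.
have m4 : measurable_fun setT (fun x => ((phi x ^+ 2) ^+ 2)%:E).
  by apply/measurable_EFinP; do 2 apply: measurable_funX.
have p4 x : (0 <= ((phi x ^+ 2) ^+ 2)%:E)%E by rewrite lee_fin sqr_ge0.
pose G x := \sum_(j < 2) partial (lift ord0 j) phi x ^+ 2.
have iG : rintegrable (lebesgue_rV 3) setT G.
  by apply: rintegrable_sum => // j; exact: (ds _).2.
have mG : measurable_fun setT (fun x => (G x)%:E) by exact: measurable_int iG.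
have G0 x : (0 <= (G x)%:E)%E by rewrite lee_fin sumr_ge0// => j _; exact: sqr_ge0.
have IG : (\int[lebesgue_rV 3]_x (G x)%:E)%E =
    (\sum_(j < 2) L2T 3 (partial (lift ord0 j) phi) ^+ 2)%:E.
  rewrite Rintegral_EFin// Rintegral_sum//; last by move=> j; exact: (ds _).2.
  by congr EFin; apply: eq_bigr => j _; rewrite sqr_L2nrm.
rewrite EFinM -IG ge0_integral_rV_consl// [X in (_ <= _ * X)%E]ge0_integral_rV_consl//.
rewrite -ge0_integralZl//; last 3 first.
- exact: (measurable_rV_cons_inner mG).
- by move=> a _; exact: integral_ge0.
- by rewrite lee_fin !mulr_ge0 ?L2nrm_ge0.
apply: ge0_le_integral => //.
- by move=> a _; exact: integral_ge0.
- exact: (measurable_rV_cons_inner m4).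
- by apply: measurable_funeM; exact: (measurable_rV_cons_inner mG).
move=> a _; have Ca := slice_C1_compact Cphi a.
have [t1 _ dt] := C1_compact_sqint Ca.
have it j := (dt j).2.
apply: le_trans (ladyzhenskaya_rV2 Ca) _.
have -> : (\int[lebesgue_rV 2]_y (G (rV_cons (a, y)))%:E)%E =
  (\sum_i L2T 2 (partial i (fun y => phi (rV_cons (a, y)))) ^+ 2)%:E.
  rewrite -[RHS](_ : (\int[lebesgue_rV 2]_y
      (\sum_(j < 2) partial j (fun y => phi (rV_cons (a, y))) y ^+ 2)%:E)%E = _).
    apply: eq_integral => y _; congr EFin; apply: eq_bigr => j _.
    by rewrite slice_partial.
  rewrite Rintegral_EFin//; last by apply: rintegrable_sum.
  rewrite Rintegral_sum//.
  by congr EFin; apply: eq_bigr => j _; rewrite sqr_L2nrm.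
rewrite -EFinM lee_fin; apply: ler_wpM2r.
  by apply: sumr_ge0 => j _; exact: sqr_ge0.
have -> : 4 * (L2T 3 phi * L2T 3 (partial ord0 phi)) =
    2 * (2 * (L2T 3 phi * L2T 3 (partial ord0 phi))) by ring.
by rewrite ler_pM2l//; exact: L2nrm_slice_le.
Qed.

(** A form common to both dimensions; the finer products of norms given by the
    two Ladyzhenskaya inequalities are estimated by the squared H^1 norm. *)
Lemma sobolev_L4 n (phi : 'rV[R]_n -> R) : n = 2%N \/ n = 3%N -> C1_compact phi ->
  L2T n (fun x => phi x ^+ 2) ^+ 2 <=
  2 * (L2T n phi ^+ 2 + \sum_i L2T n (partial i phi) ^+ 2) ^+ 2.
Proof.
move=> n23 Cphi; have [s1 s2 ds] := C1_compact_sqint Cphi.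
rewrite sqr_L2nrm -lee_fin -Rintegral_EFin//; last exact: s2.2.
have le2 (p S : R) : 0 <= p -> 0 <= S -> 2 * p * S <= 2 * (p + S) ^+ 2 by nra.
have le3 (p q S : R) : 0 <= S -> 4 * (p * q) * S <= 2 * (p ^+ 2 + (q ^+ 2 + S)) ^+ 2.
  move=> S0; have pq : 2 * (p * q) <= p ^+ 2 + q ^+ 2.
    by rewrite -subr_ge0 (_ : _ - _ = (p - q) ^+ 2) ?sqr_ge0//; ring.
  have pq0 : 0 <= p ^+ 2 + q ^+ 2 by rewrite addr_ge0// sqr_ge0.
  rewrite addrA; apply: le_trans (le2 _ _ pq0 S0).
  rewrite (_ : 4 * _ * _ = 2 * (2 * (p * q)) * S); last ring.
  by apply: ler_wpM2r => //; rewrite ler_pM2l.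
case: n23 => nE; subst n.
  apply: le_trans (ladyzhenskaya_rV2 Cphi) _; rewrite lee_fin.
  by apply: le2; [exact: sqr_ge0|apply: sumr_ge0 => j _; exact: sqr_ge0].
apply: le_trans (ladyzhenskaya_rV3 Cphi) _; rewrite lee_fin [in leRHS]big_ord_recl.
by apply: le3; apply: sumr_ge0 => j _; exact: sqr_ge0.
Qed.

End compact_support_integrals.

(** * Test functions *)

Section test_functions.
Context {R : realType} {d : nat}.
Implicit Types (f g phi psi : 'rV[R]_d -> R) (i j : 'I_d).

Lemma CkW k f : Ck k.+1 f -> Ck k f.
Proof.
elim: k f => [f []//|k IHk f [cf df Cf]]; split=> // i.
exact/IHk/Cf.
Qed.

Lemma Ck_cst k (c : R) : Ck k (cst c : 'rV[R]_d -> R).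
Proof.
elim: k c => [|k IHk] c; first exact: cst_continuous.
split=> [|i x|i]; [exact: cst_continuous|exact: derivable_cst|].
rewrite (_ : partial i (cst c) = cst 0); first exact: IHk.
by apply/funext => x; rewrite /partial derive_cst.
Qed.

Lemma derivable_coord i j (x : 'rV[R]_d) :
  derivable (fun x : 'rV[R]_d => x ord0 i) x (delta_mx ord0 j) /\
  'D_(delta_mx ord0 j) (fun x : 'rV[R]_d => x ord0 i) x = (i == j)%:R.
Proof.
have cv : (fun h : R => h^-1 *: (((fun x : 'rV[R]_d => x ord0 i) \o shift x)
    (h *: delta_mx ord0 j) - x ord0 i)) @ 0^' --> ((i == j)%:R : R).
  apply: cvg_near_cst; near=> h.
  have h0 : h != 0 by near: h; exact: nbhs_dnbhs_neq.
  by rewrite /= !mxE eqxx/= addrK [_ *: _]mulrA mulVf// mul1r eq_sym.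
by split; [apply/cvg_ex; eexists; exact: cv|exact: cvg_lim cv].
Unshelve. all: by end_near. Qed.

Lemma Ck_coord k i : Ck k (fun x : 'rV[R]_d => x ord0 i).
Proof.
have cc : continuous (fun x : 'rV[R]_d => x ord0 i) by exact: coord_continuous.
case: k => [//|k]; split=> // [j x|j]; first exact: (derivable_coord i j x).1.
rewrite (_ : partial j _ = cst (i == j)%:R); first exact: Ck_cst.
by apply/funext => x; exact: (derivable_coord i j x).2.
Qed.

Lemma Ck_lin k a b f g : Ck k f -> Ck k g -> Ck k (fun x => a * f x + b * g x).
Proof.
elim: k f g => [|k IHk] f g /=.
  by move=> cf cg x; exact: (cvgD (cvgM (cvg_cst a) (cf x)) (cvgM (cvg_cst b) (cg x))).
move=> [cf df Cf] [cg dg Cg]; split=> [x|i x|i].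
- exact: (cvgD (cvgM (cvg_cst a) (cf x)) (cvgM (cvg_cst b) (cg x))).
- exact: (derivable_lin a b (df i x) (dg i x)).1.
rewrite (_ : partial i _ = fun x => a * partial i f x + b * partial i g x); first exact: IHk.
by apply/funext => x; exact: (derivable_lin a b (df i x) (dg i x)).2.
Qed.

Lemma Ck_mul k f g : Ck k f -> Ck k g -> Ck k (fun x => f x * g x).
Proof.
elim: k f g => [|k IHk] f g /=.
  by move=> cf cg x; exact: (cvgM (cf x) (cg x)).
move=> Cf1 Cg1; have [cf df Cf] := Cf1; have [cg dg Cg] := Cg1; split=> [x|i x|i].
- exact: (cvgM (cf x) (cg x)).
- exact: (derivable_mul (df i x) (dg i x)).1.
rewrite (_ : partial i _ = fun x => 1 * (f x * partial i g x) + 1 * (g x * partial i f x)).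
  by apply: Ck_lin; apply: IHk => //; exact: CkW.
by apply/funext => x; rewrite !mul1r; exact: (derivable_mul (df i x) (dg i x)).2.
Qed.

Variable Omega : set 'rV[R]_d.
Local Notation test := (test_function Omega).
Local Notation supp f := (closure [set x | f x != 0]).

Lemma test_derivable phi i x : test phi -> derivable phi x (delta_mx ord0 i).
Proof. by move=> [/(_ 1%N)[]]. Qed.

(** Closure of the class of test functions under operations that do not enlarge
    the support. *)
Lemma test_le phi f : (forall k, Ck k f) -> test phi ->
  (forall x, f x != 0 -> supp phi x) -> test f.
Proof.
move=> Cf [_ cphi phiO] ff; have sub : supp f `<=` supp phi.
  by rewrite [X in X `<=` _]closureE; apply: smallest_sub; [exact: closed_closure|exact: ff].
split=> //; last exact: subset_trans phiO.
by apply: (subclosed_compact _ cphi sub); exact: closed_closure.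
Qed.

Lemma testMl f phi : (forall k, Ck k f) -> test phi -> test (fun x => f x * phi x).
Proof.
move=> Cf tphi; have [Cphi _ _] := tphi.
apply: (test_le _ tphi) => [k|x]; first exact: Ck_mul.
by rewrite mulf_eq0 negb_or => /andP[_ p0]; exact: subset_closure.
Qed.

Lemma testM phi psi : test phi -> test psi -> test (fun x => phi x * psi x).
Proof. by move=> [Cphi _ _]; exact: testMl. Qed.

Lemma test_lin a b phi psi : test phi -> test psi ->
  test (fun x => a * phi x + b * psi x).
Proof.
move=> [Cphi cphi phiO] [Cpsi cpsi psiO].
have sub : supp (fun x => a * phi x + b * psi x) `<=` supp phi `|` supp psi.
  rewrite -closureU; apply: closureS => x /=.
  have [->|p0 _] := eqVneq (phi x) 0; last by left.
  have [->|q0 _] := eqVneq (psi x) 0; last by right.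
  by rewrite !mulr0 addr0 eqxx.
split=> [k||]; first exact: Ck_lin.
- by apply: (subclosed_compact _ (compactU cphi cpsi) sub); exact: closed_closure.
- by apply: subset_trans sub _ => x [/phiO|/psiO].
Qed.

Lemma testB phi psi : test phi -> test psi -> test (fun x => phi x - psi x).
Proof.
move=> tp tq; have := test_lin 1 (-1) tp tq.
by under [X in test_function _ X -> _]eq_fun do rewrite mul1r mulN1r.
Qed.

Lemma test_partial phi i : test phi -> test (partial i phi).
Proof.
move=> tphi; have [Cphi _ _] := tphi.
apply: (test_le _ tphi) => [k|x]; first by have [_ _ +] := Cphi k.+1; exact.
apply: contra_neqP => nx.
have : \forall y \near x, phi y = cst 0 y.
  have : open (~` supp phi) by apply: closed_openC; exact: closed_closure.
  move=> oS; have : nbhs x (~` supp phi) by apply: open_nbhs_nbhs; split.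
  apply: filterS => y ny; apply/eqP; apply: contra_notT ny => y0.
  exact: subset_closure.
by move=> /(near_eq_derive (delta_mx ord0 i)); rewrite /partial => ->; rewrite derive_cst.
Qed.

Lemma partial_lin a b phi psi i x : test phi -> test psi ->
  partial i (fun x => a * phi x + b * psi x) x = a * partial i phi x + b * partial i psi x.
Proof.
by move=> tp tq; exact: (derivable_lin a b (test_derivable tp) (test_derivable tq)).2.
Qed.

Lemma partialB phi psi i x : test phi -> test psi ->
  partial i (fun x => phi x - psi x) x = partial i phi x - partial i psi x.
Proof.
move=> tp tq; have := @partial_lin 1 (-1) _ _ i x tp tq; rewrite mul1r mulN1r => <-.
by congr (partial i _ x); apply/funext => y; rewrite mul1r mulN1r.
Qed.

Lemma partialM phi psi i x : test phi -> test psi ->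
  partial i (fun x => phi x * psi x) x = phi x * partial i psi x + psi x * partial i phi x.
Proof.
by move=> tp tq; exact: (derivable_mul (test_derivable tp) (test_derivable tq)).2.
Qed.

Lemma test_supp phi x : test phi -> ~ Omega x -> phi x = 0.
Proof.
move=> [_ _ sO] Ox; apply/eqP; apply: contra_notT Ox => x0.
by apply: sO; exact: subset_closure.
Qed.

Lemma norm_coord_le (x : 'rV[R]_d) i : `|x ord0 i| <= `|x|.
Proof.
by rewrite [leRHS]/Num.Def.normr/= mx_normrE; exact: (le_bigmax _ (fun ij => `|x ij.1 ij.2|) (ord0, i)).
Qed.

Lemma test_C1_compact phi : test phi -> C1_compact phi.
Proof.
move=> [Cphi cphi _]; have [cp dp C1] := Cphi 1%N.
split=> //.
have [M [Mr HM]] := compact_bounded cphi.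
exists (M + 1) => x i Lx; apply/eqP; apply/negPn/negP => x0.
have sx : supp phi x by exact: subset_closure.
have := HM (M + 1) _ x sx; rewrite ltrDl ltr01 => /(_ isT) H.
by have := lt_le_trans Lx (le_trans (norm_coord_le x i) H); rewrite ltxx.
Qed.

Hypothesis oO : open Omega.
Local Notation mu := (@lebesgue_rV R d).
Local Notation nrm := (L2nrm mu Omega).
Local Notation sq := (sqint mu Omega).

Let mO : measurable Omega. Proof. exact: open_measurable_rV. Qed.

Lemma Rintegral_vanishing f : (forall x, ~ Omega x -> f x = 0) ->
  \int[mu]_(x in Omega) f x = \int[mu]_x f x.
Proof.
move=> f0; rewrite Rintegral_mkcond; apply: eq_Rintegral => x _.
by rewrite patchE; case: ifPn => //; rewrite notin_setE => /f0.
Qed.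

Lemma L2nrm_vanishing f : (forall x, ~ Omega x -> f x = 0) ->
  nrm f = L2nrm mu setT f.
Proof.
move=> f0; congr Num.sqrt; rewrite Rintegral_vanishing// => x /f0 ->.
by rewrite expr0n.
Qed.

Let sqintS f : sqint mu setT f -> sq f.
Proof.
move=> [mf if2]; split; first exact: measurable_funTS.
exact: integrableS if2.
Qed.

Lemma test_sqint phi : test phi -> sq phi.
Proof. by move=> /test_C1_compact/C1_compact_sqint[/sqintS]. Qed.

Lemma test_partial_sqint phi i : test phi -> sq (partial i phi).
Proof. by move=> /(test_partial i)/test_sqint. Qed.

Lemma test_sqr_sqint phi : test phi -> sq (fun x => phi x ^+ 2).
Proof. by move=> /test_C1_compact/C1_compact_sqint[_ /sqintS]. Qed.

Lemma Rintegral_partial_eq0 phi i : test phi -> \int[mu]_(x in Omega) partial i phi x = 0.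
Proof.
move=> tphi; rewrite Rintegral_vanishing => [|x Ox]; last exact: (test_supp (test_partial i tphi)).
by rewrite /Rintegral (integral_partial_eq0 i (test_C1_compact tphi)).
Qed.

(** The derivative of the product phi psi integrates to zero. *)
Lemma test_weak_partial phi i : test phi -> is_weak_partial Omega i phi (partial i phi).
Proof.
move=> tphi psi tpsi.
have := Rintegral_partial_eq0 i (testM tphi tpsi).
have sp := test_sqint tphi; have sq' := test_sqint tpsi.
have sdp := test_partial_sqint i tphi; have sdq := test_partial_sqint i tpsi.
have i1 := sqint_rintegrableM mO sp sdq; have i2 := sqint_rintegrableM mO sdp sq'.
under eq_Rintegral => x _ do rewrite (partialM i x tphi tpsi) [psi x * _]mulrC.
by rewrite RintegralD// => /eqP; rewrite addr_eq0 => /eqP.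
Qed.

Lemma sobolev_test phi : d = 2%N \/ d = 3%N -> test phi ->
  nrm (fun x => phi x ^+ 2) ^+ 2 <=
  2 * (nrm phi ^+ 2 + \sum_i nrm (partial i phi) ^+ 2) ^+ 2.
Proof.
move=> d23 tphi; have := sobolev_L4 d23 (test_C1_compact tphi).
have v x : ~ Omega x -> phi x = 0 by exact: test_supp.
rewrite -[L2nrm mu setT phi]L2nrm_vanishing// -L2nrm_vanishing => [|x /v ->]; last by rewrite expr0n.
rewrite (eq_bigr (fun i => nrm (partial i phi) ^+ 2))// => i _.
by rewrite L2nrm_vanishing// => x; exact: (test_supp (test_partial i tphi)).
Qed.

(** The divergence of the field phi^2 x_i e_i integrates to zero, which trades
    the integral of phi^2 for that of 2 x_i phi d_i phi. *)
Lemma poincare_test i (M : R) phi : 0 <= M -> (forall x, Omega x -> `|x ord0 i| <= M) -> test phi ->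
  nrm phi <= 2 * M * nrm (partial i phi).
Proof.
move=> M0 OM tphi.
have sp := test_sqint tphi; have sdp := test_partial_sqint i tphi.
have tx : test (fun x => x ord0 i * phi x) by apply: testMl => // k; exact: Ck_coord.
have sx := test_sqint tx.
have ixp := sqint_rintegrableM mO sx sdp; have ipp := sp.2.
have dx x : partial i (fun x => x ord0 i * phi x) x = phi x + x ord0 i * partial i phi x.
  have [_ E] := derivable_mul (derivable_coord i i x).1 (test_derivable (x := x) (i := i) tphi).
  by rewrite /partial E (derivable_coord i i x).2 eqxx mulr1 addrC.
have := Rintegral_partial_eq0 i (testM tx tphi).
rewrite (_ : partial i _ = fun x => phi x ^+ 2 + 2 * (x ord0 i * phi x * partial i phi x)); last first.
  by apply/funext => x; rewrite (partialM i x tx tphi) dx; ring.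
rewrite RintegralD//; last exact: rintegrableZ.
rewrite RintegralZl// -sqr_L2nrm => E.
have := cauchy_schwarz mO sx sdp; rewrite ler_norml => /andP[CS _].
have xM : nrm (fun x => x ord0 i * phi x) <= M * nrm phi.
  rewrite -[M in leRHS]ger0_norm// -(L2nrmZ mO)//; apply: (le_L2nrm mO) => //.
    exact: sqintZ.
  by move=> x Ox; rewrite !normrM ler_wpM2r// [`|M|]ger0_norm// OM.
have n0 := L2nrm_ge0 mu Omega phi; have dn0 := L2nrm_ge0 mu Omega (partial i phi).
have H : nrm phi * nrm phi <= nrm phi * (2 * M * nrm (partial i phi)).
  have := ler_wpM2r dn0 xM.
  have -> : nrm phi * (2 * M * nrm (partial i phi)) = 2 * (M * nrm phi * nrm (partial i phi)) by ring.
  by rewrite -expr2; lra.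
have [p0|p0] := eqVneq (nrm phi) 0.
  by rewrite p0 mulr_ge0// mulr_ge0.
by rewrite -(ler_pM2l (x := nrm phi))// lt0r p0.
Qed.

End test_functions.

(** * Approximation by test functions in H^1_0 *)

Section weak_derivatives.
Context {R : realType} {d : nat}.
Variable Omega : set 'rV[R]_d.
Hypothesis oO : open Omega.
Implicit Types (f g u v w phi psi : 'rV[R]_d -> R) (i j : 'I_d).
Local Notation mu := (@lebesgue_rV R d).
Local Notation test := (test_function Omega).
Local Notation nrm := (L2nrm mu Omega).
Local Notation sq := (sqint mu Omega).
Local Notation wpart := (weak_partial Omega).

Let mO : measurable Omega. Proof. exact: open_measurable_rV. Qed.

Lemma is_weak_partial_lin i a b u v g h : sq u -> sq v -> sq g -> sq h ->
  is_weak_partial Omega i u g -> is_weak_partial Omega i v h ->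
  is_weak_partial Omega i (fun x => a * u x + b * v x) (fun x => a * g x + b * h x).
Proof.
move=> su sv sg sh ug vh phi tphi.
have sp := test_sqint oO tphi; have sdp := test_partial_sqint oO i tphi.
have L f1 f2 f3 : sq f1 -> sq f2 -> sq f3 ->
    \int[mu]_(x in Omega) ((a * f1 x + b * f2 x) * f3 x) =
    a * \int[mu]_(x in Omega) (f1 x * f3 x) + b * \int[mu]_(x in Omega) (f2 x * f3 x).
  move=> s1 s2 s3; rewrite -Rintegral_lin//; try exact: sqint_rintegrableM.
  by apply: eq_Rintegral => x _; ring.
by rewrite !L// ug// vh//; ring.
Qed.

Lemma H1_weak_partial u i : H1 Omega u ->
  sq (wpart i u) /\ is_weak_partial Omega i u (wpart i u).
Proof. by move=> [_ /(_ i)/getPex[/(L2_sqint _ mO)]]. Qed.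

Lemma H1_sqint u : H1 Omega u -> sq u.
Proof. by move=> [/(L2_sqint _ mO)]. Qed.

Lemma H1_lin a b u v : H1 Omega u -> H1 Omega v -> H1 Omega (fun x => a * u x + b * v x).
Proof.
move=> H1u H1v; have su := H1_sqint H1u; have sv := H1_sqint H1v.
split; first by apply/(L2_sqint _ mO); exact: sqint_lin.
move=> i; have [sg ug] := H1_weak_partial i H1u; have [sh vh] := H1_weak_partial i H1v.
exists (fun x => a * wpart i u x + b * wpart i v x); split.
  by apply/(L2_sqint _ mO); exact: sqint_lin.
exact: is_weak_partial_lin.
Qed.

Lemma test_H1 phi : test phi -> H1 Omega phi.
Proof.
move=> tphi; split; first by apply/(L2_sqint _ mO); exact: test_sqint.
move=> i; exists (partial i phi); split; last exact: test_weak_partial.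
by apply/(L2_sqint _ mO); exact: test_partial_sqint.
Qed.

Lemma H1_subtest u phi : H1 Omega u -> test phi -> H1 Omega (u \- phi).
Proof.
move=> H1u tphi; have := H1_lin 1 (-1) H1u (test_H1 tphi).
by rewrite (_ : (fun x => _) = u \- phi)//; apply/funext => x; rewrite mul1r mulN1r.
Qed.

Lemma H1norm_ge u i : nrm u <= H1norm Omega u /\ nrm (wpart i u) <= H1norm Omega u.
Proof.
have wp0 l : 0 <= \int[mu]_(x in Omega) (wpart l u x ^+ 2).
  by apply: Rintegral_ge0 => x _; exact: sqr_ge0.
have u0 : 0 <= \int[mu]_(x in Omega) (u x ^+ 2).
  by apply: Rintegral_ge0 => x _; exact: sqr_ge0.
split; apply: ler_wsqrtr; first by rewrite lerDl sumr_ge0.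
by rewrite (bigD1 i)//= addrCA lerDl addr_ge0// sumr_ge0.
Qed.

(** The indeterminacy of weak derivatives: two weak derivatives of the same
    function differ by such a function ([test_null_weak_partialB]). *)
Definition test_null f := sq f /\ forall psi, test psi -> \int[mu]_(x in Omega) (f x * psi x) = 0.

Lemma test_null_weak_partialB i u g h : sq u -> sq g -> sq h ->
  is_weak_partial Omega i u g -> is_weak_partial Omega i u h ->
  test_null (fun x => g x - h x).
Proof.
move=> su sg sh ug uh; split; first exact: sqintB.
move=> psi tpsi; have sp := test_sqint oO tpsi.
have -> : \int[mu]_(x in Omega) ((g x - h x) * psi x) =
    \int[mu]_(x in Omega) (g x * psi x) - \int[mu]_(x in Omega) (h x * psi x).
  rewrite -RintegralB//; try exact: sqint_rintegrableM.
  by apply: eq_Rintegral => x _; rewrite mulrBl.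
by rewrite -[X in X - _]opprK -[X in _ - X]opprK -ug// -uh// subrr.
Qed.

Lemma test_null_limit f (a : nat -> 'rV[R]_d -> R) g : test_null f ->
  (forall n, test (a n)) -> cvgL2 mu Omega a g -> \int[mu]_(x in Omega) (f x * g x) = 0.
Proof.
move=> [sf f0] ta ag.
have := cvgL2_Rintegral mO (cvgL2_cst mO sf) ag.
rewrite (_ : (fun n => _) = cst 0); last by apply/funext => n; exact: f0.
by move=> /(cvg_unique (@Rhausdorff R) (cvg_cst 0)).
Qed.

(** phi is orthogonal to phi - g, so it is shorter than g. Thus the derivatives
    of test functions can be estimated by any weak derivative, whichever
    one has been selected. *)
Lemma L2nrm_test_le phi g : test phi -> sq g -> test_null (fun x => phi x - g x) ->
  nrm phi <= nrm g.
Proof.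
move=> tphi sg [_ /(_ _ tphi) N0]; have sp := test_sqint oO tphi.
have ipp := sp.2; have ipg := sqint_rintegrableM mO sg sp.
have E : nrm phi ^+ 2 = \int[mu]_(x in Omega) (g x * phi x).
  apply/eqP; rewrite -subr_eq0 sqr_L2nrm -RintegralB// -N0; apply/eqP.
  by apply: eq_Rintegral => x _; ring.
have := cauchy_schwarz mO sg sp; rewrite -E ger0_norm ?sqr_ge0// expr2.
have [->|p0] := eqVneq (nrm phi) 0; first by rewrite L2nrm_ge0.
by rewrite ler_pM2r// lt0r p0 L2nrm_ge0.
Qed.

Hypothesis d23 : d = 2%N \/ d = 3%N.

(** The H^1 norm of the difference is at most e times the square root of d + 1. *)
Lemma sobolev_diff phi psi (e : R) : 0 <= e -> test phi -> test psi ->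
  nrm (fun x => phi x - psi x) <= e ->
  (forall i, nrm (fun x => partial i phi x - partial i psi x) <= e) ->
  nrm (fun x => (phi x - psi x) ^+ 2) <= 2 * d.+1%:R * e ^+ 2.
Proof.
move=> e0 tp tq pe dpe; have := sobolev_test d23 (testB tp tq) => S.
rewrite -(ler_pXn2r (ltn0Sn 1)) ?nnegrE ?L2nrm_ge0 ?mulr_ge0 ?sqr_ge0//.
apply: le_trans S _.
have A : nrm (fun x => phi x - psi x) ^+ 2 <= e ^+ 2.
  by rewrite lerXn2r ?nnegrE ?L2nrm_ge0.
have B : \sum_i nrm (partial i (fun x => phi x - psi x)) ^+ 2 <= d%:R * e ^+ 2.
  rewrite -[d in d%:R]card_ord -sum1_card natr_sum mulr_suml; apply: ler_sum => i _.
  rewrite mul1r lerXn2r ?nnegrE ?L2nrm_ge0//.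
  by under [X in L2nrm _ _ X]funext => x do rewrite (partialB i x tp tq).
move: A B; set a := nrm _ ^+ 2; set S := \sum_i _ => A B.
have aS0 : 0 <= a + S.
  by apply: addr_ge0; [exact: sqr_ge0|apply: sumr_ge0 => i _; exact: sqr_ge0].
have aS : a + S <= d.+1%:R * e ^+ 2 by rewrite -natr1 mulrDl mul1r addrC lerD.
have : (a + S) ^+ 2 <= (d.+1%:R * e ^+ 2) ^+ 2 by rewrite lerXn2r ?nnegrE// (le_trans aS0).
have -> : (2 * d.+1%:R * e ^+ 2) ^+ 2 = 4 * (d.+1%:R * e ^+ 2) ^+ 2 :> R by ring.
have := sqr_ge0 (d.+1%:R * e ^+ 2 : R); lra.
Qed.

(** Let phi_n be within e_n of u in H^1 norm, and let G_n be the selected i-th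
    derivative of u - phi_n. Then d_i phi_n + G_n is a weak derivative of u, and
    N_n is its difference to the selected one, so that d_i phi_n + N_n differs
    from the latter by -G_n, which tends to zero.

    For the convergence in L^4, d_i phi_n - d_i phi_m is closer to zero than
    G_m - G_n by [L2nrm_test_le], so [sobolev_diff] bounds phi_m - phi_n in L^4.
    Letting m tend to infinity, lower semicontinuity bounds u - phi_n. *)
Lemma H10_approx u : H10 Omega u -> exists phi : nat -> 'rV[R]_d -> R,
  [/\ forall n, test (phi n), cvgL4 mu Omega phi u &
    forall i, exists N : nat -> 'rV[R]_d -> R, (forall n, test_null (N n)) /\
      cvgL2 mu Omega (fun n x => partial i (phi n) x + N n x) (wpart i u)].
Proof.
move=> [H1u apx].
have su := H1_sqint H1u.
have d0 : (0 < d)%N by case: d23 => ->.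
pose i0 := Ordinal d0.
pose e n : R := n.+1%:R^-1.
have e0 n : 0 < e n by rewrite invr_gt0.
have ecv : e n @[n --> \oo] --> 0 by exact: cvg_harmonic.
have /choice[phi phiP] n : exists phi, test phi /\ H1norm Omega (u \- phi) < e n.
  by have [phi ? ?] := apx _ (e0 n); exists phi.
have tphi n : test (phi n) by case: (phiP n).
have sphi n := test_sqint oO (tphi n).
have H1d n : H1 Omega (u \- phi n) by exact: H1_subtest.
pose G i n := wpart i (u \- phi n).
have sG i n : sq (G i n) by have [] := H1_weak_partial i (H1d n).
have GW i n : is_weak_partial Omega i (u \- phi n) (G i n) by have [] := H1_weak_partial i (H1d n).
have Ge i n : nrm (G i n) <= e n.
  by apply: le_trans (H1norm_ge _ i).2 _; exact/ltW/(phiP n).2.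
have due n : nrm (fun x => phi n x - u x) <= e n.
  rewrite L2nrmN; 
  by apply: le_trans (H1norm_ge _ i0).1 _; exact/ltW/(phiP n).2.
have sp i : sq (wpart i u) by have [] := H1_weak_partial i H1u.
have sdphi i n := test_partial_sqint oO i (tphi n).
pose N i n x := wpart i u x - (partial i (phi n) x + G i n x).
have WP i n : is_weak_partial Omega i u (fun x => partial i (phi n) x + G i n x).
  have := is_weak_partial_lin 1 1 (sphi n) (H1_sqint (H1d n)) (sdphi i n) (sG i n)
    (test_weak_partial oO i (tphi n)) (GW i n).
  rewrite (_ : (fun x => 1 * phi n x + _) = u); last by apply/funext => x /=; ring.
  by rewrite (_ : (fun x => 1 * _ + _) = (fun x => partial i (phi n) x + G i n x))//;
    apply/funext => x; rewrite !mul1r.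
have sWP i n : sq (fun x => partial i (phi n) x + G i n x) by exact: sqintD.
have N0 i n : test_null (N i n).
  apply: (@test_null_weak_partialB i u) => //.
  by have [] := H1_weak_partial i H1u.
have cL2 : cvgL2 mu Omega phi u.
  by split=> //; apply: squeeze0 ecv => n; rewrite L2nrm_ge0 due.
have dd i n m : nrm (fun x => partial i (phi n) x - partial i (phi m) x) <= e n + e m.
  apply: le_trans (_ : nrm (fun x => G i m x - G i n x) <= _).
    apply: L2nrm_test_le; [by apply: testB; exact: test_partial|exact: sqintB|].
    have := test_null_weak_partialB su (sWP i n) (sWP i m) (WP i n) (WP i m).
    rewrite (_ : (fun x => _ - _) = (fun x => partial i (phi n) x - partial i (phi m) x -
      (G i m x - G i n x)))//; apply/funext => x; ring.
  apply: le_trans (L2nrmB mO (sG i m) (sG i n)) _.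
  by rewrite addrC lerD.
have K n : sq (fun x => (u x - phi n x) ^+ 2) /\
    nrm (fun x => (u x - phi n x) ^+ 2) ^+ 2 <= (2 * d.+1%:R * (2 * e n) ^+ 2) ^+ 2.
  have sun := sqintB mO su (sphi n).
  apply: (L4_lower_semicontinuous mO sun) => eps eps0.
  have [m nm me] : exists2 m, (n <= m)%N & e m < eps.
    have [m0 _ H] := cvgr_lt _ ecv _ eps0.
    by exists (maxn n m0); [exact: leq_maxl|apply: H; exact: leq_maxr].
  have emn : e m <= e n by rewrite lef_pV2 ?posrE// ler_nat.
  exists (fun x => phi m x - phi n x); split.
  - exact: sqintB.
  - exact: (test_sqr_sqint oO (testB (tphi m) (tphi n))).
  - have en0 : 0 <= 2 * e n by rewrite mulr_ge0// ltW.
    have D0 := L2nrm_ge0 mu Omega.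
    have S : nrm (fun x => (phi m x - phi n x) ^+ 2) <= 2 * d.+1%:R * (2 * e n) ^+ 2.
      apply: sobolev_diff => // [|i].
        apply: le_trans (L2nrm_triangle mO (sphi m) su (sphi n)) _.
        have := due m; have := due n; rewrite [nrm (fun x => u x - _)]L2nrmN; lra.
      by apply: le_trans (dd i m n) _; lra.
    by rewrite lerXn2r ?nnegrE// (le_trans _ S).
  - rewrite (_ : (fun x => _ - _) = (fun x => phi m x - u x)); last by apply/funext => x; ring.
    exact: le_lt_trans (due m) me.
exists phi; split=> //.
- split=> //.
  + by move=> n; exact: test_sqr_sqint.
  + have -> : (fun x => u x ^+ 2) = (fun x => (phi 0%N x + (u x - phi 0%N x)) ^+ 2).
      by apply/funext => x; congr (_ ^+ 2); ring.
    have sub0 := sqintB mO su (sphi 0%N).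
    apply: sqint_sqrD => //; [exact: (sphi 0%N).1|exact: sub0.1| exact: test_sqr_sqint|exact: (K 0%N).1].
  + apply: (@squeeze0 _ _ (fun n => 2 * d.+1%:R * (2 * e n) ^+ 2)).
      move=> n; rewrite L2nrm_ge0/= -(ler_pXn2r (ltn0Sn 1)) ?nnegrE ?L2nrm_ge0//.
        have := (K n).2; congr (_ ^+ 2 <= _); congr L2nrm; apply/funext => x; ring.
      by rewrite mulr_ge0 ?sqr_ge0.
    rewrite -[X in _ --> X](_ : 2 * d.+1%:R * (2 * 0 * (2 * 0)) = 0); last by rewrite !mulr0.
    have e2 : 2 * e n @[n --> \oo] --> 2 * (0 : R) by apply: cvgM => //; exact: cvg_cst.
    by apply: cvgM; [exact: cvg_cst|exact: (cvgM e2 e2)].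
- move=> i; exists (N i); split=> //.
  split=> [n||]; [exact: (sqintD mO (sdphi i n) (N0 i n).1)|exact: sp|].
  apply: squeeze0 ecv => n; rewrite L2nrm_ge0/=.
  rewrite L2nrmN (_ : (fun x => _ - _) = G i n)//.
  by apply/funext => x; rewrite /N; ring.
Qed.

Lemma H10_sqint u : H10 Omega u -> sq u /\ sq (fun x => u x ^+ 2).
Proof. by move=> /H10_approx[phi [_ [[]]]]. Qed.

Lemma H10_weak_partial_sqint u i : H10 Omega u -> sq (wpart i u).
Proof. by move=> [/(H1_weak_partial i)[]]. Qed.

(** This closure contains H^1_0 and is visibly stable under linear combinations.
    For H10 itself, that stability would require relating the derivatives
    selected for a sum to those selected for its terms. *)
Definition L4_limit w :=
  exists om : nat -> 'rV[R]_d -> R, (forall n, test (om n)) /\ cvgL4 mu Omega om w.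

Lemma L4_limit_lin a b u v : H10 Omega u -> H10 Omega v ->
  L4_limit (fun x => a * u x + b * v x).
Proof.
move=> /H10_approx[p [tp cp _]] /H10_approx[q [tq cq _]].
exists (fun n x => a * p n x + b * q n x); split=> [n|]; first exact: test_lin.
by apply: (cvgL4D mO); exact: (cvgL4Z mO).
Qed.

(** The product w phi is the limit in L^2 of test functions. *)
Lemma test_null_L4 w phi f : L4_limit w -> test phi -> test_null f ->
  \int[mu]_(x in Omega) (f x * (w x * phi x)) = 0.
Proof.
move=> [om [tom com]] tphi fN.
apply: (@test_null_limit _ (fun n x => om n x * phi x)) => // [n|]; first exact: testM.
apply: (cvgL4M mO) com (cvgL4_cst mO _ _); [exact: test_sqint|exact: test_sqr_sqint].
Qed.

(** For a test function phi this is the weak derivative of w tested against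
    phi^2. For u, replace phi by the approximations of [H10_approx]: the
    corrections N_n contribute nothing by [test_null_L4], and since w is in L^4
    both sides are continuous for the convergence obtained there. *)
Lemma skew_symmetry j w q u : L4_limit w -> sq q -> is_weak_partial Omega j w q ->
  H10 Omega u ->
  \int[mu]_(x in Omega) ((w x * u x) * wpart j u x) =
  - (2^-1 * \int[mu]_(x in Omega) (q x * (u x * u x))).
Proof.
move=> Lw sq_q wq Hu.
have [phi [tphi cphi /(_ j)[N [N0 cN]]]] := H10_approx Hu.
have [om [tom com]] := Lw.
have [[_ sw _] _ sw2 _] := com.
have sphi n := test_sqint oO (tphi n).
have swphi n : sq (fun x => w x * phi n x).
  by apply: (sqintM mO); [exact: sw.1|exact: (sphi n).1|exact: sw2|exact: test_sqr_sqint].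
have sdphi n := test_partial_sqint oO j (tphi n).
have cw := cvgL4_cst mO sw sw2.
have E n : \int[mu]_(x in Omega) ((w x * phi n x) * (partial j (phi n) x + N n x)) =
    - (2^-1 * \int[mu]_(x in Omega) (q x * (phi n x * phi n x))).
  have tp2 := testM (tphi n) (tphi n).
  have := wq _ tp2.
  have -> : \int[mu]_(x in Omega) (w x * partial j (fun x => phi n x * phi n x) x) =
      2 * \int[mu]_(x in Omega) ((w x * phi n x) * partial j (phi n) x).
    rewrite -RintegralZl//; last exact: sqint_rintegrableM.
    apply: eq_Rintegral => x _; rewrite (partialM j x (tphi n) (tphi n)); ring.
  move=> H; have {}H : \int[mu]_(x in Omega) ((w x * phi n x) * partial j (phi n) x) =
    - (2^-1 * \int[mu]_(x in Omega) (q x * (phi n x * phi n x))) by lra.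
  rewrite -H -[RHS]addr0 -(test_null_L4 Lw (tphi n) (N0 n)) -RintegralD//.
  - by apply: eq_Rintegral => x _; ring.
  - exact: sqint_rintegrableM.
  - by apply: sqint_rintegrableM => //; exact: (N0 n).1.
have L1 := cvgL2_Rintegral mO (cvgL4M mO cw cphi) cN.
have L2 := cvgL2_Rintegral mO (cvgL2_cst mO sq_q) (cvgL4M mO cphi cphi).
apply: (cvg_unique (@Rhausdorff R) L1).
rewrite (funext E); apply: cvgN; apply: cvgM => //; exact: cvg_cst.
Qed.

(** The inequality for the approximating test functions passes to the limit,
    because [L2nrm_test_le] allows their derivatives to be corrected by N_n. *)
Lemma poincare_H10 i (M : R) u : 0 <= M -> (forall x, Omega x -> `|x ord0 i| <= M) ->
  H10 Omega u -> nrm u <= 2 * M * nrm (wpart i u).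
Proof.
move=> M0 OM Hu.
have [phi [tphi [[_ su cphi] _ _ _] /(_ i)[N [N0 [sN sp cN]]]]] := H10_approx Hu.
have sphi n := test_sqint oO (tphi n).
have sdphi n := test_partial_sqint oO i (tphi n).
pose A n := nrm (fun x => phi n x - u x).
pose B n := nrm (fun x => partial i (phi n) x + N n x - wpart i u x).
have le n : nrm u <= A n + 2 * M * (B n + nrm (wpart i u)).
  apply: le_trans (_ : nrm (fun x => u x - phi n x) + nrm (phi n) <= _).
    apply: le_trans (L2nrmD mO (sqintB mO su (sphi n)) (sphi n)).
    by rewrite (_ : (fun x => u x - phi n x + phi n x) = u)//; apply/funext => x; ring.
  rewrite L2nrmN lerD2l; apply: le_trans (poincare_test oO M0 OM (tphi n)) _.
  rewrite ler_wpM2l ?mulr_ge0//.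
  apply: le_trans (_ : nrm (fun x => partial i (phi n) x + N n x) <= _).
    apply: L2nrm_test_le => //; first exact: test_partial.
    have [sNn Nn0] := N0 n; split.
      rewrite (_ : (fun x => _) = (fun x => -1 * N n x)); first exact: sqintZ.
      by apply/funext => x; ring.
    move=> psi tpsi; have ip := sqint_rintegrableM mO sNn (test_sqint oO tpsi).
    have := @RintegralZl _ _ _ mu _ _ (-1) mO ip; rewrite Nn0// mulr0 => <-.
    by apply: eq_Rintegral => x _; ring.
  apply: le_trans (L2nrmD mO (sqintB mO (sN n) sp) sp).
  rewrite (_ : (fun x => partial i (phi n) x + N n x - wpart i u x + wpart i u x) =
    (fun x => partial i (phi n) x + N n x))//; apply/funext => x; ring.
have cv : A n + 2 * M * (B n + nrm (wpart i u)) @[n --> \oo] -->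
    0 + 2 * M * (0 + nrm (wpart i u)).
  apply: cvgD => //; apply: cvgM; first exact: cvg_cst.
  by apply: cvgD => //; exact: cvg_cst.
have : nrm u <= 0 + 2 * M * (0 + nrm (wpart i u)).
  by apply: (cvgr_to_ge cv); apply: nearW; exact: le.
by rewrite !add0r.
Qed.

End weak_derivatives.

(** * Convection and duality for vector fields *)

Section vector_calculus.
Context {R : realType} {d : nat}.
Variable Omega : set 'rV[R]_d.
Hypothesis oO : open Omega.
Hypothesis d23 : d = 2%N \/ d = 3%N.
Implicit Types (u v w f : 'rV[R]_d -> 'rV[R]_d) (i j : 'I_d).
Local Notation mu := (@lebesgue_rV R d).
Local Notation nrm := (L2nrm mu Omega).
Local Notation sq := (sqint mu Omega).
Local Notation wpart := (weak_partial Omega).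
Local Notation co := (component).

Let mO : measurable Omega. Proof. exact: open_measurable_rV. Qed.

Lemma mxdot_rowE (a b : 'rV[R]_d) : mxdot a b = \sum_i a ord0 i * b ord0 i.
Proof. by rewrite /mxdot big_ord1. Qed.

Lemma weak_divE u x : weak_div Omega u x = \sum_i wpart i (co i u) x.
Proof. by apply: eq_bigr => i _; rewrite mxE. Qed.

Lemma mxdot_weak_gradE u v x : mxdot (weak_grad Omega u x) (weak_grad Omega v x) =
  \sum_i \sum_j wpart j (co i u) x * wpart j (co i v) x.
Proof. by apply: eq_bigr => i _; apply: eq_bigr => j _; rewrite !mxE. Qed.

Definition sqint_field u := forall i, sq (co i u).

Lemma rintegrable_mxdot u v : sqint_field u -> sqint_field v -> rintegrable mu Omega (fun x => mxdot (u x) (v x)).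
Proof.
move=> su sv; rewrite (funext (fun x => mxdot_rowE (u x) (v x))).
by apply: (rintegrable_sum mO) => i; exact: (sqint_rintegrableM mO (su i) (sv i)).
Qed.

Lemma L2innerE u v : sqint_field u -> sqint_field v ->
  L2inner Omega u v = \sum_i \int[mu]_(x in Omega) (co i u x * co i v x).
Proof.
move=> su sv; rewrite -(Rintegral_sum mO); last by move=> i; exact: (sqint_rintegrableM mO (su i) (sv i)).
by apply: eq_Rintegral => x _; rewrite mxdot_rowE.
Qed.

Lemma H10_field_sqint u : H10_field Omega u -> sqint_field u.
Proof. by move=> Hu i; have [] := H10_sqint oO d23 (Hu i). Qed.

Lemma H10_field_wpart u i j : H10_field Omega u -> sq (wpart j (co i u)).
Proof. by move=> Hu; exact: (H10_weak_partial_sqint oO j (Hu i)). Qed.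

Lemma sqint_weak_div u : (forall j, sq (wpart j (co j u))) -> sq (weak_div Omega u).
Proof.
move=> sp; rewrite (funext (weak_divE u)).
elim: (index_enum 'I_d) => [|i s IHs].
  rewrite (_ : (fun x => _) = cst 0); last by apply/funext => x; rewrite big_nil.
  split; first exact: measurable_cst.
  by rewrite (_ : (fun x => _) = cst 0); [exact: integrable0|apply/funext => x; rewrite expr0n].
rewrite (_ : (fun x => _) = (fun x => wpart i (co i u) x + \sum_(j <- s) wpart j (co j u) x)).
  exact: sqintD.
by apply/funext => x; rewrite big_cons.
Qed.

Lemma rintegrable_mxdot_weak_grad u v : H10_field Omega u -> H10_field Omega v ->
  rintegrable mu Omega (fun x => mxdot (weak_grad Omega u x) (weak_grad Omega v x)).
Proof.
move=> Hu Hv; rewrite (funext (mxdot_weak_gradE u v)).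
apply: (rintegrable_sum mO) => i; apply: (rintegrable_sum mO) => j.
by apply: sqint_rintegrableM => //; exact: H10_field_wpart.
Qed.

(** Both terms are double sums over the components of u and w, which cancel term
    by term by [skew_symmetry]. *)
Lemma convection_eq0 w u :
  (forall j, L4_limit Omega (co j w)) -> (forall j, H1 Omega (co j w)) -> H10_field Omega u ->
  L2inner Omega (advect Omega w u) u +
  2^-1 * L2inner Omega (fun x => weak_div Omega w x *: u x) u = 0.
Proof.
move=> Lw Hw Hu.
have sw j : sq (co j w) /\ sq (fun x => co j w x ^+ 2).
  by have [om [_ [[_ s1 _] _ s2 _]]] := Lw j.
have sq_w j : sq (wpart j (co j w)) by have [] := H1_weak_partial oO j (Hw j).
have su i := H10_sqint oO d23 (Hu i).
have sp i j := H10_field_wpart i j Hu.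
have swu i j : sq (fun x => co j w x * co i u x).
  by apply: sqintM => //; [exact: (sw j).1.1|exact: (su i).1.1|exact: (sw j).2|exact: (su i).2].
have suu i : sq (fun x => co i u x * co i u x).
  by have := (su i).2; apply: eq_sqint => x; rewrite expr2.
have -> : L2inner Omega (advect Omega w u) u =
    \sum_i \sum_j \int[mu]_(x in Omega) ((co j w x * co i u x) * wpart j (co i u) x).
  transitivity (\int[mu]_(x in Omega)
      (\sum_i \sum_j ((co j w x * co i u x) * wpart j (co i u) x))).
    apply: eq_Rintegral => x _; rewrite mxdot_rowE; apply: eq_bigr => i _.
    by rewrite mxE mulr_suml; apply: eq_bigr => j _; rewrite mxE /component; ring.
  have iF i j : rintegrable mu Omega (fun x => (co j w x * co i u x) * wpart j (co i u) x).
    exact: sqint_rintegrableM.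
  rewrite (Rintegral_sum mO); last by move=> i; exact: (rintegrable_sum mO).
  by apply: eq_bigr => i _; rewrite (Rintegral_sum mO).
have -> : L2inner Omega (fun x => weak_div Omega w x *: u x) u =
    \sum_i \sum_j \int[mu]_(x in Omega) (wpart j (co j w) x * (co i u x * co i u x)).
  transitivity (\int[mu]_(x in Omega)
      (\sum_i \sum_j (wpart j (co j w) x * (co i u x * co i u x)))).
    apply: eq_Rintegral => x _; rewrite mxdot_rowE; apply: eq_bigr => i _.
    by rewrite mxE weak_divE -mulrA mulr_suml.
  have iF i j : rintegrable mu Omega (fun x => wpart j (co j w) x * (co i u x * co i u x)).
    exact: sqint_rintegrableM.
  rewrite (Rintegral_sum mO); last by move=> i; exact: (rintegrable_sum mO).
  by apply: eq_bigr => i _; rewrite (Rintegral_sum mO).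
rewrite mulr_sumr -big_split/= big1// => i _.
rewrite mulr_sumr -big_split/= big1// => j _.
have [_ wq] := H1_weak_partial oO j (Hw j).
by rewrite (skew_symmetry oO d23 (Lw j) (sq_w j) wq (Hu i)) addNr.
Qed.

Lemma extrapolate_component um1 (u : nat -> 'rV[R]_d -> 'rV[R]_d) n j :
  co j (extrapolate um1 u n) =
  (fun x => 2 * co j (u n) x + -1 * co j (if n is m.+1 then u m else um1) x).
Proof.
by apply/funext => x; rewrite /component /extrapolate !mxE mulN1r; case: n.
Qed.

Lemma extrapolate_convection_eq0 um1 (u : nat -> 'rV[R]_d -> 'rV[R]_d) n :
  H10_field Omega um1 -> (forall n, H10_field Omega (u n)) ->
  L2inner Omega (advect Omega (extrapolate um1 u n) (u n.+1)) (u n.+1) +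
  2^-1 * L2inner Omega (fun x => weak_div Omega (extrapolate um1 u n) x *: u n.+1 x) (u n.+1) = 0.
Proof.
move=> Hum1 Hu.
have Hp : H10_field Omega (if n is m.+1 then u m else um1) by case: (n).
apply: (convection_eq0 _ _ (Hu n.+1)) => j; rewrite extrapolate_component.
  exact: (L4_limit_lin oO d23 2 (-1) (Hu n j) (Hp j)).
exact: (H1_lin oO 2 (-1) (Hu n j).1 (Hp j).1).
Qed.

Lemma sqr_L2norm_weak_grad u : L2norm Omega (weak_grad Omega u) ^+ 2 =
  \int[mu]_(x in Omega) mxdot (weak_grad Omega u x) (weak_grad Omega u x).
Proof.
rewrite sqr_sqrtr//; apply: Rintegral_ge0 => x _.
by apply: sumr_ge0 => i _; apply: sumr_ge0 => j _; rewrite -expr2 sqr_ge0.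
Qed.

Lemma L2nrm_weak_partial_le u i j : H10_field Omega u ->
  nrm (wpart j (co i u)) <= L2norm Omega (weak_grad Omega u).
Proof.
move=> Hu; rewrite -(ler_pXn2r (ltn0Sn 1)) ?nnegrE ?sqrtr_ge0//.
rewrite sqr_L2norm_weak_grad sqr_L2nrm; apply: (le_Rintegral mO).
- exact: (H10_field_wpart i j Hu).2.
- exact: rintegrable_mxdot_weak_grad.
have s0 a b x : 0 <= wpart a (co b u) x * wpart a (co b u) x by rewrite -expr2 sqr_ge0.
move=> x _; rewrite mxdot_weak_gradE expr2.
apply: (@le_trans _ _ (\sum_l wpart l (co i u) x * wpart l (co i u) x)).
  by rewrite (bigD1 j)//= lerDl sumr_ge0.
rewrite [leRHS](bigD1 i)//= lerDl; apply: sumr_ge0 => a _.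
exact: sumr_ge0.
Qed.

Hypothesis bO : bounded_set Omega.

(** The inequality [poincare_H10] in the first coordinate direction. *)
Lemma poincare_field : exists2 C : R, 0 <= C &
  forall u i, H10_field Omega u -> nrm (co i u) <= C * L2norm Omega (weak_grad Omega u).
Proof.
have d0 : (0 < d)%N by case: d23 => ->.
pose i0 := Ordinal d0.
have [M [_ HM]] := bO.
pose M' : R := `|M| + 1.
have M'0 : 0 <= M' by rewrite /M' addr_ge0.
have OM x : Omega x -> `|x ord0 i0| <= M'.
  move=> Ox; apply: le_trans (norm_coord_le x i0) _; apply: (HM M' _ x Ox).
  by rewrite (le_lt_trans (ler_norm M))// /M' ltrDl.
exists (2 * M') => [|u i Hu]; first by rewrite mulr_ge0.
apply: le_trans (poincare_H10 oO d23 M'0 OM (Hu i)) _.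
by apply: ler_wpM2l; [rewrite mulr_ge0|exact: L2nrm_weak_partial_le].
Qed.

(** By [poincare_field] the quotients defining the dual norm are bounded, so
    their supremum bounds each of them. A field that vanishes almost everywhere
    is left out of that supremum; its pairing is zero, as is that of a field with
    zero gradient, for which the quotient is meaningless. *)
Lemma dual_pairing f u : sqint_field f -> H10_field Omega u ->
  L2inner Omega f u = 0 \/
  L2inner Omega f u <= dual_norm Omega f * L2norm Omega (weak_grad Omega u).
Proof.
move=> sf Hu; have [C C0 PC] := poincare_field.
pose F : R := \sum_i nrm (co i f).
have F0 : 0 <= F by apply: sumr_ge0 => i _; exact: L2nrm_ge0.
have g0 v : 0 <= L2norm Omega (weak_grad Omega v) by exact: sqrtr_ge0.
have pair v : H10_field Omega v ->
    `|L2inner Omega f v| <= F * C * L2norm Omega (weak_grad Omega v).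
  move=> Hv; have sv := H10_field_sqint Hv; rewrite L2innerE//.
  apply: le_trans (ler_norm_sum _ _ _) _; rewrite -mulrA mulr_suml; apply: ler_sum => i _.
  apply: le_trans (cauchy_schwarz mO (sf i) (sv i)) _.
  by apply: ler_wpM2l; [exact: L2nrm_ge0|exact: PC].
have [u0|un0] := pselect {ae mu, forall x, Omega x -> u x = 0}.
  left; rewrite L2innerE//; last exact: H10_field_sqint.
  apply: big1 => i _; apply/eqP; rewrite -normr_le0.
  apply: le_trans (cauchy_schwarz mO (sf i) (H10_field_sqint Hu i)) _.
  rewrite (L2nrm_ae_eq0 mO (H10_field_sqint Hu i)) ?mulr0//.
  by apply: filterS u0 => x ux0 Ox; rewrite /component ux0// mxE.
have [gE|gn0] := eqVneq (L2norm Omega (weak_grad Omega u)) 0.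
  by left; apply/eqP; rewrite -normr_le0; have := pair u Hu; rewrite gE mulr0.
have gp : 0 < L2norm Omega (weak_grad Omega u) by rewrite lt0r gn0 g0.
right; rewrite -ler_pdivrMr//; apply: sup_upper_bound; last by exists u.
split; first by exists (L2inner Omega f u / L2norm Omega (weak_grad Omega u)); exists u.
exists (F * C) => _ [v [Hv _] <-].
have [->|gvn0] := eqVneq (L2norm Omega (weak_grad Omega v)) 0.
  by rewrite invr0 mulr0 mulr_ge0.
rewrite ler_pdivrMr; last by rewrite lt0r gvn0 g0.
by apply: le_trans (pair v Hv); exact: ler_norm.
Qed.

End vector_calculus.

(** * The energy balance of one time step *)

Section energy.
Context {R : realType} {d : nat}.
Variable Omega : set 'rV[R]_d.
Hypotheses (oO : open Omega) (d23 : d = 2%N \/ d = 3%N).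
Local Notation mu := (@lebesgue_rV R d).
Implicit Types u v f : 'rV[R]_d -> 'rV[R]_d.

Let mO : measurable Omega. Proof. exact: open_measurable_rV. Qed.

Lemma Rintegral_energy (c e : R) u v : H10_field Omega u -> H10_field Omega v ->
  \int[mu]_(x in Omega)
      (2^-1 * mxdot (u x - v x) (u x - v x)
       + c * mxdot (weak_grad Omega u x) (weak_grad Omega u x)
       + e * weak_div Omega u x ^+ 2) =
  2^-1 * L2inner Omega (fun x => u x - v x) (fun x => u x - v x)
  + c * L2norm Omega (weak_grad Omega u) ^+ 2
  + e * \int[mu]_(x in Omega) (weak_div Omega u x ^+ 2).
Proof.
move=> Hu Hv; rewrite sqr_L2norm_weak_grad.
have su := H10_field_sqint oO d23 Hu; have sv := H10_field_sqint oO d23 Hv.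
have sd : sqint_field Omega (fun x => u x - v x).
  by move=> i; apply: eq_sqint (sqintB mO (su i) (sv i)) => x; rewrite /component !mxE.
have i1 := rintegrable_mxdot oO sd sd.
have i2 := rintegrable_mxdot_weak_grad oO Hu Hu.
have i3 : rintegrable mu Omega (fun x => weak_div Omega u x ^+ 2).
  by apply: (sqint_weak_div oO _).2 => j; exact: H10_field_wpart.
have z1 := rintegrableZ mO 2^-1 i1; have z2 := rintegrableZ mO c i2; have z3 := rintegrableZ mO e i3.
by rewrite !RintegralD//; [rewrite !RintegralZl//|exact: rintegrableD].
Qed.

Lemma L2inner_increment u v : sqint_field Omega u -> sqint_field Omega v ->
  L2inner Omega (fun x => u x - v x) u =
  2^-1 * L2inner Omega u u - 2^-1 * L2inner Omega v v
  + 2^-1 * L2inner Omega (fun x => u x - v x) (fun x => u x - v x).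
Proof.
move=> su sv.
have sd : sqint_field Omega (fun x => u x - v x).
  by move=> i; apply: eq_sqint (sqintB mO (su i) (sv i)) => x; rewrite /component !mxE.
have iu := rintegrableZ mO 2^-1 (rintegrable_mxdot oO su su).
have iv := rintegrableZ mO 2^-1 (rintegrable_mxdot oO sv sv).
have id := rintegrableZ mO 2^-1 (rintegrable_mxdot oO sd sd).
rewrite -!RintegralZl//; try exact: rintegrable_mxdot.
rewrite -RintegralB// -RintegralD//; last exact: rintegrableB.
apply: eq_Rintegral => x _; rewrite !mxdot_rowE !mulr_sumr -sumrB -big_split/=.
by apply: eq_bigr => i _; rewrite !mxE; field.
Qed.

Lemma L2innerC u v : L2inner Omega u v = L2inner Omega v u.
Proof.
by apply: eq_Rintegral => x _; rewrite !mxdot_rowE; apply: eq_bigr => i _; rewrite mulrC.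
Qed.

End energy.

Theorem theorem3p1 (R : realType) (d : nat) (Omega : set 'rV[R]_d)
    (k nu : R) (eps : nat -> R) (f : nat -> 'rV[R]_d -> 'rV[R]_d)
    (um1 : 'rV[R]_d -> 'rV[R]_d) (u : nat -> 'rV[R]_d -> 'rV[R]_d)
    (hd : d = 2%N \/ d = 3%N)
    (hOmega : bounded_domain Omega)
    (hk : 0 < k) (hnu : 0 < nu)
    (heps : forall n : nat, 0 < eps n.+1)
    (hf : forall n : nat, L2_field Omega (f n.+1))
    (hum1 : H10_field Omega um1) (hu : forall n : nat, H10_field Omega (u n))
    (hmethod : forall n : nat,
      penalty_step Omega k nu (eps n.+1) (f n.+1) (extrapolate um1 u n)
        (u n) (u n.+1))
    (M : nat) (hM : (0 < M)%N) :
  2^-1 * \int[lebesgue_rV d]_(x in Omega) mxdot (u M x) (u M x)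
  + \sum_(0 <= n < M) \int[lebesgue_rV d]_(x in Omega)
      (2^-1 * mxdot (u n.+1 x - u n x) (u n.+1 x - u n x)
       + k * nu * mxdot (weak_grad Omega (u n.+1) x) (weak_grad Omega (u n.+1) x)
       + k / eps n.+1 * weak_div Omega (u n.+1) x ^+ 2)
  = 2^-1 * \int[lebesgue_rV d]_(x in Omega) mxdot (u 0%N x) (u 0%N x)
    + \sum_(0 <= n < M)
        k * \int[lebesgue_rV d]_(x in Omega) mxdot (u n.+1 x) (f n.+1 x)
  /\
  2^-1 * \int[lebesgue_rV d]_(x in Omega) mxdot (u M x) (u M x)
  + \sum_(0 <= n < M) \int[lebesgue_rV d]_(x in Omega)
      (2^-1 * mxdot (u n.+1 x - u n x) (u n.+1 x - u n x)
       + k * nu / 2 * mxdot (weak_grad Omega (u n.+1) x) (weak_grad Omega (u n.+1) x)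
       + k / eps n.+1 * weak_div Omega (u n.+1) x ^+ 2)
  <= 2^-1 * \int[lebesgue_rV d]_(x in Omega) mxdot (u 0%N x) (u 0%N x)
     + \sum_(0 <= n < M) k / (2 * nu) * dual_norm Omega (f n.+1) ^+ 2.
Proof.
have [oO _ _ bO] := hOmega.
pose E n := 2^-1 * L2inner Omega (u n) (u n).
pose I n := 2^-1 * L2inner Omega (fun x => u n.+1 x - u n x) (fun x => u n.+1 x - u n x).
pose G n := L2norm Omega (weak_grad Omega (u n.+1)).
pose D n := \int[lebesgue_rV d]_(x in Omega) (weak_div Omega (u n.+1) x ^+ 2).
pose P n := L2inner Omega (f n.+1) (u n.+1).
(* The weak equation tested with u n.+1 and multiplied by k. *)
have step n : E n.+1 + (I n + k * nu * G n ^+ 2 + k / eps n.+1 * D n) = E n + k * P n.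
  have sq m := H10_field_sqint oO hd (hu m).
  have C := extrapolate_convection_eq0 oO hd n hum1 hu.
  have H := hmethod n (u n.+1) (hu n.+1).
  rewrite (L2inner_increment oO (sq n.+1) (sq n)) -/(E n.+1) -/(E n) -/(I n) -/(P n) in H.
  rewrite -[L2inner _ (weak_grad _ _) _]sqr_L2norm_weak_grad -/(G n) in H.
  rewrite -(_ : D n = \int[lebesgue_rV d]_(x in Omega)
    (weak_div Omega (u n.+1) x * weak_div Omega (u n.+1) x)) in H; last first.
    by apply: eq_Rintegral => x _; rewrite expr2.
  rewrite -[k^-1 * _ + _ + _]addrA C addr0 in H.
  rewrite -H; field.
  by rewrite !gt_eqF.
have telescope (B : nat -> R) : E M + \sum_(0 <= n < M) B n =
    E 0%N + \sum_(0 <= n < M) (E n.+1 + B n - E n).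
  elim: (M) => [|m IHm]; first by rewrite !big_geq.
  by rewrite !big_nat_recr//= [RHS]addrA -IHm; ring.
have energyE c n : \int[lebesgue_rV d]_(x in Omega)
      (2^-1 * mxdot (u n.+1 x - u n x) (u n.+1 x - u n x)
       + c * mxdot (weak_grad Omega (u n.+1) x) (weak_grad Omega (u n.+1) x)
       + k / eps n.+1 * weak_div Omega (u n.+1) x ^+ 2) =
    I n + c * G n ^+ 2 + k / eps n.+1 * D n.
  exact: (Rintegral_energy oO hd _ _ (hu n.+1) (hu n)).
rewrite -/(L2inner Omega (u M) (u M)) -/(L2inner Omega (u 0%N) (u 0%N)) -/(E M) -/(E 0%N).
split.
- rewrite (eq_bigr _ (fun n _ => energyE (k * nu) n)).
  rewrite telescope; congr (_ + _); apply: eq_bigr => n _.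
  by rewrite step addrC addKr /P L2innerC.
- rewrite (eq_bigr _ (fun n _ => energyE (k * nu / 2) n)).
  rewrite telescope lerD2l; apply: ler_sum => n _.
  have sfn : sqint_field Omega (f n.+1).
    by move=> i; exact/(L2_sqint _ (open_measurable_rV oO))/(hf n i).
  have kP : k * P n <= k * nu / 2 * G n ^+ 2 + k / (2 * nu) * dual_norm Omega (f n.+1) ^+ 2.
    set N := dual_norm _ _.
    (* Young's inequality, with the square that it neglects made explicit. *)
    have -> : k * nu / 2 * G n ^+ 2 + k / (2 * nu) * N ^+ 2 =
        k * (N * G n) + k / (2 * nu) * (nu * G n - N) ^+ 2.
      by field; rewrite gt_eqF.
    have c0 : 0 <= k / (2 * nu) by rewrite divr_ge0 ?mulr_ge0 ?ltW.
    have sq0 := mulr_ge0 c0 (sqr_ge0 (nu * G n - N)).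
    have [P0|PN] := dual_pairing oO hd bO sfn (hu n.+1); last first.
      apply: le_trans (_ : k * (N * G n) <= _); first by rewrite ler_pM2l.
      by rewrite lerDl.
    rewrite /P P0 mulr0.
    have -> : k * (N * G n) + k / (2 * nu) * (nu * G n - N) ^+ 2 =
        k / (2 * nu) * ((nu * G n) ^+ 2 + N ^+ 2).
      by field; rewrite gt_eqF.
    by rewrite mulr_ge0// addr_ge0 ?sqr_ge0.
  have := step n; lra.
Qed.
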